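(* Let $E/\mathbb{Q}$ be an elliptic curve and let $T$ be one of the fifteen groups $C_1,\dots,C_{10},C_{12}$, $C_2\times C_2$, $C_2\times C_4$, $C_2\times C_6$, $C_2\times C_8$ (the torsion groups allowed by Mazur's theorem), where $C_m$ is the cyclic group of order $m$. If $T$ embeds in $E(\mathbb{Q})_{\mathrm{tors}}$, then $\operatorname{rmm}(E)=R_i$ for some $i$ in the following set depending on $T$: $T=C_1$: $i\in\{1,\dots,12\}$; $T\in\{C_2,C_4,C_2\times C_2\}$: $i\in\{1,3,5,7,8,9,10,11,12\}$; $T=C_3$: $i\in\{1,2,5,6,7,8,9,10\}$; $T=C_5$: $i\in\{4,6,7,12\}$; $T=C_6$: $i\in\{1,5,7,8,9,10\}$; $T\in\{C_7,C_9\}$: $i\in\{7,10\}$; $T\in\{C_8,C_2\times C_4\}$: $i\in\{3,5,7,12\}$; $T\in\{C_{10},C_2\times C_8\}$: $i=7$; $T\in\{C_{12},C_2\times C_6\}$: $i\in\{7,8,9,10\}$.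
   Context: A global minimal model of an elliptic curve $E/\mathbb{Q}$ is a Weierstrass model $y^2+a_1xy+a_3y=x^3+a_2x^2+a_4x+a_6$ with all $a_j\in\mathbb{Z}$, $\mathbb{Q}$-isomorphic to $E$, whose discriminant has minimal absolute value among all such integral models. The reduced minimal model of $E$ is the (unique) global minimal model with $a_1,a_3\in\{0,1\}$ and $a_2\in\{-1,0,1\}$; one writes $\operatorname{rmm}(E)=(a_1,a_2,a_3)$ for its coefficients. For $1\le i\le 12$, $R_i=(a_1,a_2,a_3)$ is defined by: $R_1=(0,0,0)$, $R_2=(0,0,1)$, $R_3=(0,-1,0)$, $R_4=(0,-1,1)$, $R_5=(0,1,0)$, $R_6=(0,1,1)$, $R_7=(1,0,0)$, $R_8=(1,0,1)$, $R_9=(1,-1,0)$, $R_{10}=(1,-1,1)$, $R_{11}=(1,1,0)$, $R_{12}=(1,1,1)$. *)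

(* Defs.v *)
From mathcomp Require Import all_boot all_order all_algebra.
Set Implicit Arguments.
Unset Strict Implicit.
Unset Printing Implicit Defensive.
Import Order.TTheory GRing.Theory Num.Theory.
Local Open Scope ring_scope.

(** The equation y^2 + a1 x y + a3 y = x^3 + a2 x^2 + a4 x + a6. *)
Record weierstrass (R : Type) : Type :=
  Weierstrass { a1 : R; a2 : R; a3 : R; a4 : R; a6 : R }.

Definition map_weierstrass (R S : Type) (f : R -> S) (W : weierstrass R) :
    weierstrass S :=
  Weierstrass (f (a1 W)) (f (a2 W)) (f (a3 W)) (f (a4 W)) (f (a6 W)).

Section Discriminant.
Variables (R : comNzRingType) (W : weierstrass R).

Definition b2 : R := a1 W ^+ 2 + 4 * a2 W.
Definition b4 : R := 2 * a4 W + a1 W * a3 W.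
Definition b6 : R := a3 W ^+ 2 + 4 * a6 W.
Definition b8 : R :=
  a1 W ^+ 2 * a6 W + 4 * a2 W * a6 W - a1 W * a3 W * a4 W
  + a2 W * a3 W ^+ 2 - a4 W ^+ 2.

Definition disc : R :=
  - b2 ^+ 2 * b8 - 8 * b4 ^+ 3 - 27 * b6 ^+ 2 + 9 * b2 * b4 * b6.

End Discriminant.

(** An elliptic curve over F is given by a Weierstrass equation over F. *)
Definition elliptic (F : fieldType) (E : weierstrass F) : Prop :=
  disc E != 0.

(** Result of the substitution x = u^2 x' + r, y = u^3 y' + u^2 s x' + t,
    followed by division of the equation by u^6. *)
Definition change_vars (F : fieldType) (u r s t : F) (E : weierstrass F) :
    weierstrass F :=
  Weierstrass
    ((a1 E + 2 * s) / u)
    ((a2 E - s * a1 E + 3 * r - s ^+ 2) / u ^+ 2)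
    ((a3 E + r * a1 E + 2 * t) / u ^+ 3)
    ((a4 E - s * a3 E + 2 * r * a2 E - (t + r * s) * a1 E + 3 * r ^+ 2
      - 2 * s * t) / u ^+ 4)
    ((a6 E + r * a4 E + r ^+ 2 * a2 E + r ^+ 3 - t * a3 E - t ^+ 2
      - r * t * a1 E) / u ^+ 6).

(** Every isomorphism over F between curves in Weierstrass form that fixes the
    point at infinity is such a change of variables. *)
Definition isomorphic (F : fieldType) (E E' : weierstrass F) : Prop :=
  exists u r s t : F, u != 0 /\ E' = change_vars u r s t E.

Inductive point (F : Type) : Type := Infinity | Affine of F & F.
Arguments Infinity {F}.

Section GroupLaw.
Variables (F : fieldType) (E : weierstrass F).

Definition on_curve (P : point F) : Prop :=
  match P with
  | Infinity => True
  | Affine x y =>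
      y ^+ 2 + a1 E * x * y + a3 E * y
      = x ^+ 3 + a2 E * x ^+ 2 + a4 E * x + a6 E
  end.

(** Chord-and-tangent addition, meaningful for points on the curve. There,
    [x1 = x2] leaves only [P2 = - P1], the first test, or [P2 = P1], where
    [l] is the slope of the tangent. *)
Definition add_point (P1 P2 : point F) : point F :=
  match P1, P2 with
  | Infinity, _ => P2
  | _, Infinity => P1
  | Affine x1 y1, Affine x2 y2 =>
      if (x1 == x2) && (y1 + y2 + a1 E * x2 + a3 E == 0) then Infinity
      else
        let l :=
          if x1 == x2
          then (3 * x1 ^+ 2 + 2 * a2 E * x1 + a4 E - a1 E * y1)
               / (2 * y1 + a1 E * x1 + a3 E)
          else (y2 - y1) / (x2 - x1) in
        let x3 := l ^+ 2 + a1 E * l - a2 E - x1 - x2 in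
        Affine x3 (- (l + a1 E) * x3 - (y1 - l * x1) - a3 E)
  end.

Definition torsion_point (P : point F) : Prop :=
  on_curve P /\
  exists n : nat, (0 < n)%N /\ iter n (add_point P) Infinity = Infinity.

Definition embeds_in_torsion (T : zmodType) : Prop :=
  exists f : T -> point F,
    [/\ injective f,
        forall g, torsion_point (f g)
      & forall g h, f (g + h) = add_point (f g) (f h)].

End GroupLaw.

Definition global_minimal_model (E : weierstrass rat) (W : weierstrass int) :
    Prop :=
  isomorphic E (map_weierstrass intr W) /\
  forall W' : weierstrass int,
    isomorphic E (map_weierstrass intr W') -> `|disc W| <= `|disc W'|.

Definition reduced_minimal_model (E : weierstrass rat) (W : weierstrass int) :
    Prop :=
  [/\ global_minimal_model E W,
      a1 W \in [:: 0; 1],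
      a3 W \in [:: 0; 1]
    & a2 W \in [:: -1; 0; 1]].

(** [rmm E = c]: the reduced minimal model of [E], which exists and is unique,
    has [(a1, a2, a3) = c]. *)
Definition rmm_eq (E : weierstrass rat) (c : int * int * int) : Prop :=
  exists W : weierstrass int,
    unique (reduced_minimal_model E) W /\ (a1 W, a2 W, a3 W) = c.

(** Indexed from 1 to 12; other indices are not used. *)
Definition R (i : nat) : int * int * int :=
  nth (0, 0, 0)
    [:: (0, 0, 0); (0, 0, 1); (0, -1, 0); (0, -1, 1); (0, 1, 0); (0, 1, 1);
        (1, 0, 0); (1, 0, 1); (1, -1, 0); (1, -1, 1); (1, 1, 0); (1, 1, 1)]
    i.-1.

Inductive mazur_group : Type :=
  | C1 | C2 | C3 | C4 | C5 | C6 | C7 | C8 | C9 | C10 | C12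
  | C2xC2 | C2xC4 | C2xC6 | C2xC8.

(** ['I_m] with addition modulo [m]. *)
Definition mazur_carrier (T : mazur_group) : zmodType :=
  match T with
  | C1 => 'I_1
  | C2 => 'I_2
  | C3 => 'I_3
  | C4 => 'I_4
  | C5 => 'I_5
  | C6 => 'I_6
  | C7 => 'I_7
  | C8 => 'I_8
  | C9 => 'I_9
  | C10 => 'I_10
  | C12 => 'I_12
  | C2xC2 => ('I_2 * 'I_2)%type
  | C2xC4 => ('I_2 * 'I_4)%type
  | C2xC6 => ('I_2 * 'I_6)%type
  | C2xC8 => ('I_2 * 'I_8)%type
  end.

Definition rmm_indices (T : mazur_group) : seq nat :=
  match T with
  | C1 => [:: 1; 2; 3; 4; 5; 6; 7; 8; 9; 10; 11; 12]
  | C2 | C4 | C2xC2 => [:: 1; 3; 5; 7; 8; 9; 10; 11; 12]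
  | C3 => [:: 1; 2; 5; 6; 7; 8; 9; 10]
  | C5 => [:: 4; 6; 7; 12]
  | C6 => [:: 1; 5; 7; 8; 9; 10]
  | C7 | C9 => [:: 7; 10]
  | C8 | C2xC4 => [:: 3; 5; 7; 12]
  | C10 | C2xC8 => [:: 7]
  | C12 | C2xC6 => [:: 7; 8; 9; 10]
  end%N.

(* Main.v *)
(* Torsion points of order greater than 2 on an integral model mostly have integral
   coordinates. If P and 2P are integral, an integral shift moves P to (0, 0) and
   the minimal model to y^2 + A1 xy + A3 y = x^3 + A2 x^2, still minimal. When more
   multiples of P are integral, so are c, d, e with A1 = c - e, A2 = de, A3 = cde,
   and the order of P is an equation between c, d, e (c + d = 0 for order 5,
   d(c + d) = ce for order 7, and so on). Minimality forbids that 2 or 3 divides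
   all the parameters, and the residues modulo 2 and 3 of A1, A3 and
   A1^2 + 4 A2 determine the index of the reduced minimal model; it remains to
   inspect residue classes. *)
Require Import Defs.
From HB Require Import structures.
From mathcomp Require Import all_boot all_order all_algebra.
From mathcomp Require Import ring zify.
From Stdlib Require Import Classical.
Set Implicit Arguments.
Unset Strict Implicit.
Unset Printing Implicit Defensive.
Import Order.TTheory GRing.Theory Num.Theory.
Local Open Scope ring_scope.


(** * Changes of variables and the group law *)

(** All relations between multiples of P are computed in [T] and carried to the curve by [f]. The
    obstacle is integrality: a point of order 2 may have x in (1/4)Z. Since 64 = 63 + 1 = 65 - 1, a
    point of order 3, 5, 7 or 9 returns to itself up to sign after six doublings; for orders 4 and 8
    integrality descends from 4 x(2P) to x(P). Both arguments use only the expansion of x(2P) near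
    infinity, at one prime at a time. When x(2P) or x(4P) belongs to a point of order 2, the
    parameters of the Tate form are integral only up to a factor 2 or 4, and this factor is carried
    along or removed by congruences. For a group mixing 2-torsion with 3- or 5-torsion, the index
    sets of the two parts are intersected. This is not sharp for C_10, C_12 and C_2 x C_6: there the
    equation of the points of one order, written on the Tate form of another point, supplies the
    missing congruence. *)

Definition shift (A : comNzRingType) (r s t : A) (E : weierstrass A) :
    weierstrass A :=
  Weierstrass (a1 E + 2 * s)
    (a2 E - s * a1 E + 3 * r - s ^+ 2)
    (a3 E + r * a1 E + 2 * t)
    (a4 E - s * a3 E + 2 * r * a2 E - (t + r * s) * a1 E + 3 * r ^+ 2
      - 2 * s * t)
    (a6 E + r * a4 E + r ^+ 2 * a2 E + r ^+ 3 - t * a3 E - t ^+ 2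
      - r * t * a1 E).

Lemma change_vars1 (F : fieldType) (r s t : F) (E : weierstrass F) :
  change_vars 1 r s t E = shift r s t E.
Proof. by rewrite /change_vars /shift !expr1n !divr1. Qed.

Lemma map_shift (r s t : int) (W : weierstrass int) :
  map_weierstrass intr (shift r s t W) =
  shift r%:~R s%:~R t%:~R (map_weierstrass intr W) :> weierstrass rat.
Proof. by rewrite /shift /map_weierstrass /=; congr Weierstrass; ring. Qed.

Lemma disc_shift (A : comNzRingType) (r s t : A) (E : weierstrass A) :
  disc (shift r s t E) = disc E.
Proof. by case: E => *; rewrite /disc /b8 /b6 /b4 /b2 /=; ring. Qed.

Lemma disc_change_vars (F : fieldType) (u r s t : F) (E : weierstrass F) :
  u != 0 -> disc (change_vars u r s t E) = disc E / u ^+ 12.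
Proof.
move=> u0; rewrite -(disc_shift r s t E).
by case: E => *; rewrite /disc /b8 /b6 /b4 /b2 /=; field.
Qed.

Lemma change_vars_comp (F : fieldType) (u r s t u' r' s' t' : F)
    (E : weierstrass F) : u != 0 -> u' != 0 ->
  change_vars u' r' s' t' (change_vars u r s t E) =
  change_vars (u * u') (u ^+ 2 * r' + r) (u * s' + s)
    (u ^+ 3 * t' + u ^+ 2 * s * r' + t) E.
Proof.
move=> u0 u0'; case: E => *; rewrite /change_vars /=.
by congr Weierstrass; field; rewrite u0 u0'.
Qed.

Lemma change_varsK (F : fieldType) (u r s t : F) (E : weierstrass F) :
  u != 0 ->
  change_vars u^-1 (- r / u ^+ 2) (- s / u) ((r * s - t) / u ^+ 3)
    (change_vars u r s t E) = E.
Proof.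
move=> u0; rewrite change_vars_comp ?invr_eq0 //.
by case: E => *; rewrite /change_vars /=; congr Weierstrass; field; rewrite u0 oner_neq0.
Qed.

Lemma isomorphic_trans (F : fieldType) (E1 E2 E3 : weierstrass F) :
  isomorphic E1 E2 -> isomorphic E2 E3 -> isomorphic E1 E3.
Proof.
case=> u [r [s [t [u0 ->]]]] [u' [r' [s' [t' [u0' ->]]]]].
rewrite change_vars_comp //; do 4 eexists; split; last by [].
by rewrite mulf_neq0.
Qed.

Lemma isomorphic_sym (F : fieldType) (E1 E2 : weierstrass F) :
  isomorphic E1 E2 -> isomorphic E2 E1.
Proof.
case=> u [r [s [t [u0 ->]]]]; exists u^-1, (- r / u ^+ 2), (- s / u).
by exists ((r * s - t) / u ^+ 3); rewrite change_varsK // invr_eq0.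
Qed.

Lemma isomorphic_shift (F : fieldType) (r s t : F) (E : weierstrass F) :
  isomorphic E (shift r s t E).
Proof. by exists 1, r, s, t; rewrite oner_neq0 change_vars1. Qed.

(** The substitution of [change_vars] solved for the new coordinates, with u^2 x' replaced by x -
    r. *)
Definition move_point (F : fieldType) (u r s t : F) (P : point F) : point F :=
  match P with
  | Infinity => Infinity
  | Affine x y => Affine ((x - r) / u ^+ 2) ((y - s * (x - r) - t) / u ^+ 3)
  end.

Lemma move_point_inj (F : fieldType) (u r s t : F) :
  u != 0 -> injective (move_point u r s t).
Proof.
move=> u0 [|x y] [|x' y'] //= [ex ey].
have ux : u ^+ 2 != 0 by rewrite expf_neq0.
have uy : u ^+ 3 != 0 by rewrite expf_neq0.
move/(mulIf (invr_neq0 ux)): ex => ex; move/(mulIf (invr_neq0 uy)): ey => ey.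
have xx : x = x' by rewrite -(subrK r x) ex subrK.
by rewrite xx in ey *; rewrite (addIr _ (addIr _ ey)).
Qed.

Lemma on_curve_eqx (F : fieldType) (E : weierstrass F) (x y y' : F) :
  on_curve E (Affine x y) -> on_curve E (Affine x y') ->
  y = y' \/ y + y' + a1 E * x + a3 E = 0.
Proof.
move=> /= h h'; have : (y - y') * (y + y' + a1 E * x + a3 E) = 0.
  transitivity ((y ^+ 2 + a1 E * x * y + a3 E * y)
    - (y' ^+ 2 + a1 E * x * y' + a3 E * y')); first by ring.
  by rewrite h h' subrr.
by move/eqP; rewrite mulf_eq0 subr_eq0 => /orP [] /eqP; [left|right].
Qed.

Lemma on_curve_move (F : fieldType) (u r s t : F) (E : weierstrass F) P :
  u != 0 -> on_curve E P ->
  on_curve (change_vars u r s t E) (move_point u r s t P).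
Proof.
move=> u0; case: P => [//|x y] /=; case: E => c1 c2 c3 c4 c6 /= h.
apply/eqP; rewrite -subr_eq0; apply/eqP.
transitivity ((y ^+ 2 + c1 * x * y + c3 * y
  - (x ^+ 3 + c2 * x ^+ 2 + c4 * x + c6)) / u ^+ 6); first by field.
by rewrite h subrr mul0r.
Qed.

Lemma add_point_move (F : fieldType) (u r s t : F) (E : weierstrass F) P Q :
  u != 0 -> on_curve E P -> on_curve E Q ->
  add_point (change_vars u r s t E) (move_point u r s t P)
    (move_point u r s t Q) = move_point u r s t (add_point E P Q).
Proof.
move=> u0; case: P => [//|x y]; case: Q => [//|x' y'] oP oQ.
rewrite /add_point /=.
have ux : (u ^+ 2)^-1 != 0 by rewrite invr_eq0 expf_neq0.
have uy : (u ^+ 3)^-1 != 0 by rewrite invr_eq0 expf_neq0.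
have -> : ((x - r) / u ^+ 2 == (x' - r) / u ^+ 2) = (x == x').
  by rewrite (inj_eq (mulIf ux)) (inj_eq (addIr _)).
have addE l l' : l' = (l - s) / u ->
  let X' := l' ^+ 2 + (a1 E + 2 * s) / u * l'
    - (a2 E - s * a1 E + 3 * r - s ^+ 2) / u ^+ 2 - (x - r) / u ^+ 2
    - (x' - r) / u ^+ 2 in
  let X := l ^+ 2 + a1 E * l - a2 E - x - x' in
  Affine X' (- (l' + (a1 E + 2 * s) / u) * X'
    - ((y - s * (x - r) - t) / u ^+ 3 - l' * ((x - r) / u ^+ 2))
    - (a3 E + r * a1 E + 2 * t) / u ^+ 3) =
  Affine ((X - r) / u ^+ 2)
    ((- (l + a1 E) * X - (y - l * x) - a3 E - s * (X - r) - t) / u ^+ 3).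
  by move=> -> /=; congr Affine; field.
have [xx /=|nx /=] := eqVneq x x'; last first.
  have d0 : x' - x != 0 by rewrite subr_eq0 eq_sym.
  by apply: addE; field; rewrite u0 d0.
rewrite -{}xx in oQ addE *.
have -> : (y - s * (x - r) - t) / u ^+ 3 + (y' - s * (x - r) - t) / u ^+ 3
  + (a1 E + 2 * s) / u * ((x - r) / u ^+ 2) + (a3 E + r * a1 E + 2 * t) / u ^+ 3
  = (y + y' + a1 E * x + a3 E) * (u ^+ 3)^-1 by field.
rewrite mulf_eq0 (negPf uy) orbF; have [//|e0] := eqVneq (_ + a3 E) 0.
case: (on_curve_eqx oP oQ) e0 => [<-|->]; last by rewrite eqxx.
move=> e0; apply: addE; field; rewrite u0 /=.
by have -> : 2 * y = y + y by ring.
Qed.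

Definition embedding (F : fieldType) (E : weierstrass F) (T : zmodType)
    (f : T -> point F) : Prop :=
  [/\ injective f, forall g, on_curve E (f g)
    & forall g h, f (g + h) = add_point E (f g) (f h)].

Lemma embedding_move (F : fieldType) (u r s t : F) (E : weierstrass F)
    (T : zmodType) (f : T -> point F) : u != 0 -> embedding E f ->
  embedding (change_vars u r s t E) (move_point u r s t \o f).
Proof.
move=> u0 [fI fC fD]; split=> [|g|g h] /=.
- exact: inj_comp (move_point_inj u0) fI.
- exact: on_curve_move.
- by rewrite fD add_point_move.
Qed.

(** An affine [f 0] would be its own double. Putting X = x in the tangent formula gives y = - y - a1
    x - a3, the very case that [add_point] sends to infinity. *)
Lemma embedding0 (F : fieldType) (E : weierstrass F) (T : zmodType)
    (f : T -> point F) : embedding E f -> f 0 = Infinity.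
Proof.
case=> _ _ fD; have := fD 0 0; rewrite addr0.
case: (f 0) => [//|x y] /=; rewrite eqxx /=.
case: eqP => // e0; set l := _ / _; set X := l ^+ 2 + _ - _ - _ - _.
move=> [eX eY]; case: e0; rewrite -eX in eY; rewrite {1}eY; ring.
Qed.

Lemma embedding_affine (F : fieldType) (E : weierstrass F) (T : zmodType)
    (f : T -> point F) (g : T) : embedding E f -> g != 0 ->
  exists x y, f g = Affine x y.
Proof.
move=> ef; case e: (f g) => [|x y]; last by exists x, y.
by case/eqP; case: (ef) => fI _ _; apply: fI; rewrite (embedding0 ef).
Qed.

Lemma embeddingN (F : fieldType) (E : weierstrass F) (T : zmodType)
    (f : T -> point F) (g : T) (x y : F) : embedding E f ->
  f g = Affine x y -> f (- g) = Affine x (- y - a1 E * x - a3 E).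
Proof.
move=> ef eg; have [_ _ fD] := ef; have := fD g (- g).
rewrite subrr (embedding0 ef) eg; case: (f _) => [//|x' y'] /=.
case: eqP => //= <-; case: eqP => //= e0 _; congr Affine.
by apply/eqP; rewrite -subr_eq0 -[X in _ == X]e0; apply/eqP; ring.
Qed.

Lemma embedding_eqx (F : fieldType) (E : weierstrass F) (T : zmodType)
    (f : T -> point F) (g h : T) (x y y' : F) : embedding E f ->
  f g = Affine x y -> f h = Affine x y' -> h = g \/ h = - g.
Proof.
move=> ef eg eh; have [fI fC _] := ef.
have := fC g; have := fC h; rewrite eg eh => ch cg.
case: (on_curve_eqx cg ch) => e; [left|right]; apply: fI.
  by rewrite eg eh e.
rewrite (embeddingN ef eg) eh; congr Affine.
by apply/eqP; rewrite -subr_eq0 -[X in _ == X]e; apply/eqP; ring.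
Qed.

Lemma embedding_order2 (F : fieldType) (E : weierstrass F) (T : zmodType)
    (f : T -> point F) (g : T) (x y : F) : embedding E f ->
  f g = Affine x y -> g + g = 0 -> 2 * y + a1 E * x + a3 E = 0.
Proof.
move=> ef eg /eqP; rewrite addr_eq0 => /eqP gg.
have := embeddingN ef eg; rewrite -gg eg => -[ey].
by rewrite [2 * y](_ : _ = y + y); [rewrite {1}ey|]; ring.
Qed.

Lemma embedding_double (F : fieldType) (E : weierstrass F) (T : zmodType)
    (f : T -> point F) (g : T) (x y : F) : embedding E f ->
  f g = Affine x y -> g + g != 0 ->
  2 * y + a1 E * x + a3 E != 0 /\
  let l := (3 * x ^+ 2 + 2 * a2 E * x + a4 E - a1 E * y)
           / (2 * y + a1 E * x + a3 E) in
  let X := l ^+ 2 + a1 E * l - a2 E - x - x in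
  f (g + g) = Affine X (- (l + a1 E) * X - (y - l * x) - a3 E).
Proof.
move=> ef eg gg; have [fI _ fD] := ef.
have y2 : y + y + a1 E * x + a3 E = 2 * y + a1 E * x + a3 E by ring.
have e0 : 2 * y + a1 E * x + a3 E != 0.
  apply: contraNneq gg => e0; rewrite addr_eq0; apply/eqP/fI.
  rewrite (embeddingN ef eg) eg; congr Affine.
  by apply/eqP; rewrite -subr_eq0 -[X in _ == X]e0; apply/eqP; ring.
by split=> // l X; rewrite fD eg /= eqxx y2 (negPf e0) /=.
Qed.

Lemma embedding_chord (F : fieldType) (E : weierstrass F) (T : zmodType)
    (f : T -> point F) (g h : T) (x y x' y' : F) : embedding E f ->
  f g = Affine x y -> f h = Affine x' y' -> h != g -> h != - g ->
  x' - x != 0 /\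
  let l := (y' - y) / (x' - x) in
  let X := l ^+ 2 + a1 E * l - a2 E - x - x' in
  f (g + h) = Affine X (- (l + a1 E) * X - (y - l * x) - a3 E).
Proof.
move=> ef eg eh n1 n2; have [_ _ fD] := ef.
have nx : x' != x.
  apply: contraNneq n1 => ex; rewrite ex in eh.
  by case: (embedding_eqx ef eg eh) n2 => ->; rewrite ?eqxx.
by rewrite subr_eq0; split=> // l X; rewrite fD eg eh /= eq_sym (negPf nx).
Qed.


(** * Integrality of torsion points *)

(** The rational root theorem. Degree 4 suffices throughout: equations of lower degree are
    multiplied by powers of x. *)
Lemma denq_root4 (k a b c e : int) (x : rat) :
  k%:~R * x ^+ 4 + a%:~R * x ^+ 3 + b%:~R * x ^+ 2 + c%:~R * x + e%:~R = 0 ->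
  (denq x %| k)%Z.
Proof.
move=> h; pose n := numq x; pose d := denq x.
have d0 : d%:~R != 0 :> rat by rewrite intr_eq0 denq_neq0.
have xE : x = n%:~R / d%:~R by rewrite divq_num_den.
have key : k * n ^+ 4
    = - (a * n ^+ 3 + b * n ^+ 2 * d + c * n * d ^+ 2 + e * d ^+ 3) * d.
  apply: (@intr_inj rat); apply/eqP; rewrite -subr_eq0; apply/eqP.
  transitivity (d%:~R ^+ 4 * (k%:~R * x ^+ 4 + a%:~R * x ^+ 3
    + b%:~R * x ^+ 2 + c%:~R * x + e%:~R)); last by rewrite h mulr0.
  by rewrite xE; field.
have : (d %| k * n ^+ 4)%Z by rewrite key dvdz_mull.
rewrite Gauss_dvdzl // /coprimez; apply/eqP.
suff : coprimez d (n ^+ 4) by move/eqP.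
by rewrite coprimezXr // coprimez_sym; apply: coprime_num_den.
Qed.

Lemma int_denq_dvd1 (x : rat) : (denq x %| 1)%Z -> x \is a Num.int.
Proof.
rewrite dvdz1 => /eqP h; have d1 : denq x = 1.
  by have := denq_gt0 x; lia.
by rewrite -(divq_num_den x) d1 divr1 intr_int.
Qed.

Lemma int_root3 (a b c : int) (x : rat) :
  x ^+ 3 + a%:~R * x ^+ 2 + b%:~R * x + c%:~R = 0 -> x \is a Num.int.
Proof.
move=> h; apply/int_denq_dvd1/(@denq_root4 1 a b c 0).
by rewrite [LHS](_ : _ = x * (x ^+ 3 + a%:~R * x ^+ 2 + b%:~R * x + c%:~R));
  [rewrite h mulr0|ring].
Qed.

Lemma int_root2 (a b : int) (x : rat) :
  x ^+ 2 + a%:~R * x + b%:~R = 0 -> x \is a Num.int.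
Proof.
move=> h; apply: (@int_root3 a b 0).
by rewrite [LHS](_ : _ = x * (x ^+ 2 + a%:~R * x + b%:~R));
  [rewrite h mulr0|ring].
Qed.

(* The localization of Z at [p]. *)
Definition zloc (p : nat) : {pred rat} :=
  [pred q : rat | coprimez p%:Z (denq q)].

Lemma zlocP (p : nat) (q : rat) :
  reflect (exists n m : int, coprimez p%:Z m /\ q = n%:~R / m%:~R)
    (q \in zloc p).
Proof.
apply: (iffP idP) => [h|[n [m [h ->]]]].
  by exists (numq q), (denq q); rewrite divq_num_den.
rewrite inE; have [->|m0] := eqVneq m 0; first by rewrite invr0 mulr0 coprimezE coprimen1.
have : (denq (n%:~R / m%:~R) %| m)%Z.
  (* n/m is a root of m X^4 - n X^3. *)
  apply: (@denq_root4 m (- n) 0 0 0); rewrite rmorphN /=; field.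
  by rewrite intr_eq0.
by move=> dm; apply: coprimez_dvdr h.
Qed.

Lemma zloc_subring_closed (p : nat) : subring_closed (zloc p).
Proof.
have nz (q : rat) : (denq q)%:~R != 0 :> rat by rewrite intr_eq0 denq_neq0.
split=> [|x y px py|x y px py]; first by rewrite inE coprimezE coprimen1.
- apply/zlocP; exists (numq x * denq y - numq y * denq x), (denq x * denq y).
  split; first by rewrite coprimezMr [coprimez _ _]px.
  by rewrite -{1}(divq_num_den x) -{1}(divq_num_den y); field; rewrite !nz.
apply/zlocP; exists (numq x * numq y), (denq x * denq y).
split; first by rewrite coprimezMr [coprimez _ _]px.
by rewrite -{1}(divq_num_den x) -{1}(divq_num_den y); field; rewrite !nz.
Qed.

HB.instance Definition _ (p : nat) :=
  GRing.isSubringClosed.Build rat (zloc p) (zloc_subring_closed p).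

Lemma zloc_dvd (p k : nat) (n : int) (q : rat) :
  q \in zloc p -> n%:~R = (p ^ k)%:R * q -> (p ^ k %| `|n|)%N.
Proof.
case: k => [|k]; first by rewrite expn0 dvd1n.
case/zlocP=> a [m [h ->]] e.
have [m0|m0] := eqVneq m 0.
  by move: e; rewrite m0 invr0 !mulr0 => /eqP; rewrite intr_eq0 => /eqP ->.
have key : n * m = (p ^ k.+1)%:Z * a.
  apply: (@intr_inj rat); rewrite !rmorphM /= e -!pmulrn; field.
  by rewrite intr_eq0.
have : ((p ^ k.+1)%:Z %| n * m)%Z by rewrite key dvdz_mulr.
rewrite Gauss_dvdzl; last first.
  by rewrite coprimezE /=; apply: coprimeXl.
by rewrite dvdzE.
Qed.

Lemma zloc_unit (p : nat) (q : rat) :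
  (1 < p)%N -> q \in zloc p ->
  (1 + p%:R * q)^-1 \in zloc p /\ 1 + p%:R * q != 0.
Proof.
move=> p1 /zlocP [n [m [h ->]]].
have m0 : m != 0.
  by apply: contraTneq h => ->; rewrite coprimezE /= /coprime gcdn0; lia.
have c : coprimez p%:Z (m + p%:Z * n).
  by rewrite /coprimez addrC mulrC gcdzMDl.
have mn0 : m + p%:Z * n != 0.
  by apply: contraTneq c => ->; rewrite coprimezE /= /coprime gcdn0; lia.
have mq : m%:~R != 0 :> rat by rewrite intr_eq0.
have mnq : m%:~R + p%:R * n%:~R != 0 :> rat.
  by rewrite (_ : _ + _ = (m + p%:Z * n)%:~R) ?intr_eq0 // rmorphD rmorphM.
have -> : 1 + p%:R * (n%:~R / m%:~R) = (m%:~R + p%:R * n%:~R) / m%:~R :> rat.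
  by field.
split; last by rewrite mulf_neq0 ?invr_eq0.
apply/zlocP; exists m, (m + p%:Z * n); split=> //.
by rewrite rmorphD rmorphM /= invf_div.
Qed.

(** The localization is a valuation ring with maximal ideal generated by p. *)
Lemma zloc_inv (p : nat) (q : rat) : prime p -> q \notin zloc p ->
  q != 0 /\ exists2 w, w \in zloc p & q^-1 = p%:R * w.
Proof.
move=> pp; rewrite inE coprimezE /= prime_coprime // negbK => pd.
have q0 : q != 0 by apply: contraTneq pd => ->; rewrite dvdn1; case: p pp => [|[]].
split=> //; have /dvdzP [d ed] : (p%:Z %| denq q)%Z by rewrite dvdzE.
exists (d%:~R / (numq q)%:~R).
  apply/zlocP; exists d, (numq q); split=> //.
  rewrite coprimezE coprime_sym.
  by apply: coprime_dvdr (coprime_num_den q); rewrite ed abszM dvdn_mull.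
rewrite -{1}(divq_num_den q) invf_div ed rmorphM /= mulrA; congr (_ / _).
by rewrite mulrC.
Qed.

Lemma int_zloc (q : rat) :
  (forall p : nat, prime p -> q \in zloc p) -> q \is a Num.int.
Proof.
move=> h; apply/int_denq_dvd1; rewrite dvdz1; apply: contraT => d1.
have := h _ (pdiv_prime (n := `|denq q|%N) _).
rewrite inE coprimezE /= => /(_ _); rewrite prime_coprime ?pdiv_prime //.
  by rewrite pdiv_dvd => /(_ _) /=; apply; have := denq_gt0 q; lia.
by have := denq_gt0 q; lia.
Qed.

Lemma zloc_div (p k : nat) (n : int) : prime p ->
  n%:~R / (p ^ k)%:R \in zloc p -> (p ^ k %| `|n|)%N.
Proof.
move=> pp h; apply: (zloc_dvd h); field.
by rewrite pnatr_eq0 expn_eq0; case: p pp {h}.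
Qed.


(* x(2P) = dblnum x / psi2 x for P = (x, y), see [double_x]. *)
Definition psi2 (A : comNzRingType) (E : weierstrass A) (x : A) : A :=
  4 * x ^+ 3 + b2 E * x ^+ 2 + 2 * b4 E * x + b6 E.

Definition dblnum (A : comNzRingType) (E : weierstrass A) (x : A) : A :=
  x ^+ 4 - b4 E * x ^+ 2 - 2 * b6 E * x - b8 E.

Lemma psi2_sqr (F : fieldType) (E : weierstrass F) (x y : F) :
  on_curve E (Affine x y) -> (2 * y + a1 E * x + a3 E) ^+ 2 = psi2 E x.
Proof.
move=> /= h; rewrite /psi2 /b2 /b4 /b6.
transitivity (4 * (y ^+ 2 + a1 E * x * y + a3 E * y)
  + (a1 E * x + a3 E) ^+ 2); first by ring.
by rewrite h; ring.
Qed.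

Lemma double_x (F : fieldType) (E : weierstrass F) (T : zmodType)
    (f : T -> point F) (g : T) (x y x' y' : F) : embedding E f ->
  f g = Affine x y -> f (g + g) = Affine x' y' ->
  psi2 E x != 0 /\ x' * psi2 E x = dblnum E x.
Proof.
move=> ef eg e2.
have gg : g + g != 0.
  by apply/eqP => gg; move: e2; rewrite gg (embedding0 ef).
have c : on_curve E (Affine x y) by case: (ef) => _ /(_ g); rewrite eg.
have [e0] := embedding_double ef eg gg; rewrite e2 /= => -[-> _].
have p0 : psi2 E x != 0 by rewrite -(psi2_sqr c) expf_neq0.
split=> //; rewrite -{1}(psi2_sqr c).
(* The tangent formula cleared of denominators agrees with [dblnum] up to a multiple of the curve
   equation, which is the last summand. *)
have -> : dblnum E x = (3 * x ^+ 2 + 2 * a2 E * x + a4 E - a1 E * y) ^+ 2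
  + a1 E * (3 * x ^+ 2 + 2 * a2 E * x + a4 E - a1 E * y)
    * (2 * y + a1 E * x + a3 E)
  - (a2 E + 2 * x) * (2 * y + a1 E * x + a3 E) ^+ 2
  + (8 * x + a1 E ^+ 2 + 4 * a2 E) * 
    (y ^+ 2 + a1 E * x * y + a3 E * y
     - (x ^+ 3 + a2 E * x ^+ 2 + a4 E * x + a6 E)).
  rewrite /dblnum /b4 /b6 /b8; ring.
move: c => /= ->; rewrite subrr mulr0 addr0; field.
by [].
Qed.

Lemma b2_map (W : weierstrass int) :
  b2 (map_weierstrass intr W) = (b2 W)%:~R :> rat.
Proof. by rewrite /b2 /=; ring. Qed.
Lemma b4_map (W : weierstrass int) :
  b4 (map_weierstrass intr W) = (b4 W)%:~R :> rat.
Proof. by rewrite /b4 /=; ring. Qed.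
Lemma b6_map (W : weierstrass int) :
  b6 (map_weierstrass intr W) = (b6 W)%:~R :> rat.
Proof. by rewrite /b6 /=; ring. Qed.
Lemma b8_map (W : weierstrass int) :
  b8 (map_weierstrass intr W) = (b8 W)%:~R :> rat.
Proof. by rewrite /b8 /=; ring. Qed.

(** Since y^2 balances x^3, a pole of x at p has even order, in particular order at least 2. *)
Lemma zloc_pole (p : nat) (W : weierstrass int) (x y : rat) : prime p ->
  on_curve (map_weierstrass intr W) (Affine x y) -> x \notin zloc p ->
  x != 0 /\ exists2 z, z \in zloc p & x^-1 = (p ^ 2)%:R * z.
Proof.
move=> pp /= c nx; have p1 := prime_gt1 pp.
have p0 : p%:R != 0 :> rat by rewrite pnatr_eq0; lia.
have [x0 [w wz xw]] := zloc_inv pp nx; split=> //.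
have w0 : w != 0 by apply: contraNneq x0 => e; rewrite -invr_eq0 xw e mulr0.
have xE : x = (p%:R * w)^-1 by rewrite -xw invrK.
pose v : rat := (a2 W)%:~R * w + (a4 W)%:~R * p%:R * w ^+ 2
  + (a6 W)%:~R * p%:R ^+ 2 * w ^+ 3.
have vz : v \in zloc p.
  by rewrite !(rpredD, rpredM, rpredX, rpred_int, rpred_nat).
have [Uz U0] := zloc_unit p1 vz.
(* [xi] is y / (p x^2). The curve equation times p^3 w^4 is quadratic in it, and once [xi] is
   p-integral this equation shows that p divides w. *)
pose xi := y * p%:R * w ^+ 2.
have key : p%:R * xi ^+ 2 + (a1 W)%:~R * p%:R * w * xi
    + (a3 W)%:~R * p%:R ^+ 2 * w ^+ 2 * xi = w * (1 + p%:R * v).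
  transitivity (p%:R ^+ 3 * w ^+ 4 * (y ^+ 2 + (a1 W)%:~R * x * y
     + (a3 W)%:~R * y)); first by rewrite /xi xE; field; rewrite p0 w0.
  by rewrite c /v xE; field; rewrite p0 w0.
(* Otherwise 1/xi = p z, and the quadratic equation divided by (p xi)^2 would make 1/p
   p-integral. *)
have xiz : xi \in zloc p.
  apply: contraT => /(zloc_inv pp) [xi0 [z zz xiE]].
  have /(zloc_div (k := 1) (n := 1) pp) : 1 / (p ^ 1)%:R \in zloc p.
    have -> : 1 / (p ^ 1)%:R = z ^+ 2 * w * (1 + p%:R * v)
      - (a1 W)%:~R * w * z - (a3 W)%:~R * p%:R * w ^+ 2 * z.
      rewrite -mulrA -key.
      have -> : z = (p%:R * xi)^-1 by rewrite invfM xiE mulKf.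
      by rewrite expn1; field; rewrite p0 xi0.
    by rewrite !(rpredD, rpredB, rpredN, rpredM, rpredX, rpred_int, rpred_nat, rpred1).
  by rewrite expn1 dvdn1 => /eqP e1; rewrite e1 in p1.
clearbody xi.
exists ((xi ^+ 2 + (a1 W)%:~R * w * xi
    + (a3 W)%:~R * p%:R * w ^+ 2 * xi) / (1 + p%:R * v)).
  by rewrite !(rpredD, rpredM, rpredX, rpred_int, rpred_nat).
rewrite xw; apply: (mulIf U0); rewrite -[LHS]mulrA -key natrX; field.
by rewrite U0.
Qed.

(** With z = 1/x, 1/x(2P) is (4 z + b2 z^2 + 2 b4 z^3 + b6 z^4) / (1 - b4 z^2 - 2 b6 z^3 - b8 z^4),
    and this denominator is a unit at p. *)
Lemma zloc_double (p : nat) (W : weierstrass int) (x x' : rat) : prime p ->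
  x \notin zloc p -> psi2 (map_weierstrass intr W) x != 0 ->
  x' * psi2 (map_weierstrass intr W) x = dblnum (map_weierstrass intr W) x ->
  x' \notin zloc p /\ exists2 c, c \in zloc p &
  x'^-1 = 4 * x^-1 + (b2 W)%:~R * x^-1 ^+ 2 + c * x^-1 ^+ 3.
Proof.
move=> pp nx; rewrite /psi2 /dblnum b2_map b4_map b6_map b8_map => f0 e.
have p1 := prime_gt1 pp.
have p0 : p%:R != 0 :> rat by rewrite pnatr_eq0; lia.
have [x0 [w wz xw]] := zloc_inv pp nx.
have w0 : w != 0 by apply: contraNneq x0 => h; rewrite -invr_eq0 xw h mulr0.
have xE : x = (p%:R * w)^-1 by rewrite -xw invrK.
pose v : rat := - (b4 W)%:~R * p%:R * w ^+ 2 - 2 * (b6 W)%:~R * p%:R ^+ 2 * w ^+ 3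
  - (b8 W)%:~R * p%:R ^+ 3 * w ^+ 4.
have zE := (rpredD, rpredB, rpredN, rpredM, rpredX, rpred_int, rpred_nat, rpred1).
have vz : v \in zloc p by rewrite !zE.
have [Uz U0] := zloc_unit p1 vz.
have NE : dblnum (map_weierstrass intr W) x = x ^+ 4 * (1 + p%:R * v).
  by rewrite /dblnum b4_map b6_map b8_map xE /v; field; rewrite p0 w0.
rewrite /dblnum b4_map b6_map b8_map in NE; rewrite NE in e.
have x'0 : x' != 0.
  apply: contraTneq U0 => h; move: e; rewrite h mul0r => /esym/eqP.
  by rewrite mulf_eq0 expf_eq0 /= (negPf x0) /= => /eqP ->; rewrite eqxx.
have x'E : x'^-1 = (4 * x ^+ 3 + (b2 W)%:~R * x ^+ 2 + 2 * (b4 W)%:~R * x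
    + (b6 W)%:~R) / (x ^+ 4 * (1 + p%:R * v)).
  by rewrite -e; field; rewrite x'0 f0.
split.
  apply/negP => x'z.
  have /(zloc_div (k := 1) (n := 1) pp) : 1 / (p ^ 1)%:R \in zloc p.
    have -> : 1 / (p ^ 1)%:R = x' * w * (4 + (b2 W)%:~R * (p%:R * w)
      + 2 * (b4 W)%:~R * (p%:R * w) ^+ 2 + (b6 W)%:~R * (p%:R * w) ^+ 3)
      * (1 + p%:R * v)^-1.
      rewrite expn1 -{1}(mulVf x'0) x'E xE; field; rewrite p0 w0 /=.
      by rewrite U0.
    by rewrite !zE.
  by rewrite expn1 dvdn1 => /eqP e1; rewrite e1 in p1.
(* The remainder after subtracting 4 z + b2 z^2 from that quotient, divided by z^3; here z = p w. *)
exists ((2 * (b4 W)%:~R + (b6 W)%:~R * (p%:R * w)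
  + (4 + (b2 W)%:~R * (p%:R * w)) * ((b4 W)%:~R + 2 * (b6 W)%:~R * (p%:R * w)
  + (b8 W)%:~R * (p%:R * w) ^+ 2)) * (1 + p%:R * v)^-1); first by rewrite !zE.
rewrite x'E xE /v in U0 *; field; rewrite p0 w0 /=.
by move: U0; rewrite /v => U0; apply: contraNneq U0 => <-; apply/eqP; ring.
Qed.


(** Substitution of z = A w + K b2 w^2 + O(w^3) into 4 z + b2 z^2 + O(z^3), where w is 1/x of the
    initial point. *)
Lemma zloc_double_step (p : nat) (W : weierstrass int) (T : zmodType)
    (f : T -> point rat) (h : T) (w A K : rat) : prime p ->
  embedding (map_weierstrass intr W) f -> w \in zloc p -> h + h != 0 ->
  A \in zloc p -> K \in zloc p ->
  (exists x y, [/\ f h = Affine x y, x \notin zloc p & exists2 c, c \in zloc p &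
     x^-1 = A * w + K * (b2 W)%:~R * w ^+ 2 + c * w ^+ 3]) ->
  exists x y, [/\ f (h + h) = Affine x y, x \notin zloc p &
     exists2 c, c \in zloc p &
     x^-1 = (4 * A) * w + (4 * K + A ^+ 2) * (b2 W)%:~R * w ^+ 2
       + c * w ^+ 3].
Proof.
move=> pp ef wz hh Az Kz [x [y [eh nx [c cz xE]]]].
have [x' [y' eh2]] := embedding_affine ef hh.
have [F0 FE] := double_x ef eh eh2.
have [nx' [c' c'z x'E]] := zloc_double pp nx F0 FE.
exists x', y'; split=> //.
pose u := K * (b2 W)%:~R + c * w.
exists (4 * c + (b2 W)%:~R * (2 * A * u + u ^+ 2 * w)
  + c' * (A + u * w) ^+ 3).
  by rewrite !(rpredD, rpredM, rpredX, rpred_int, rpred_nat, rpred1).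
by rewrite x'E xE /u; ring.
Qed.

(** The recursion K' = 4 K + 16^i with K = 0 at i = 0 gives 12 K = 16^i - 4^i. At i = 6 this
    identity shows that 3 divides K. *)
Lemma pow4_mul (A : comNzRingType) :
  ((4 : A) ^+ 6) ^+ 2 - 4 ^+ 6 = 12 * (3 * (5 * 7 * 13 * 4 ^+ 5)).
Proof. ring. Qed.

Lemma pow4_6 (A : comNzRingType) : (4 : A) ^+ 6 = 9 * (5 * (7 * 13)) + 1.
Proof. ring. Qed.

(* The constants of six doublings: w goes to 4^6 w + K b2 w^2 + O(w^3). *)
Lemma doubling_constants (p : nat) : exists (N : int) (k : rat), [/\
  `|N|%N = (9 * (5 * (7 * 13)))%N, k \in zloc p, 4 ^+ 6 = N%:~R + 1 :> rat &
  forall K : rat, 12 * K = (4 ^+ 6) ^+ 2 - 4 ^+ 6 -> K = 3 * k].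
Proof.
exists (9 * (5 * (7 * 13))), (5 * 7 * 13 * 4 ^+ 5); split.
- by rewrite !abszM.
- by rewrite !(rpredM, rpredX, rpred_nat).
- by rewrite pow4_6 !rmorphM.
move=> K KE; apply: (@mulfI _ 12); [by clear|rewrite {}KE].
by rewrite pow4_mul.
Qed.

Lemma mul2n_neq0 (T : zmodType) (g : T) (i j : nat) : g != 0 ->
  g *+ 2 ^ j = g \/ g *+ 2 ^ j = - g -> (i <= j)%N -> g *+ 2 ^ i != 0.
Proof.
move=> g0 gj ij; apply: contraNneq g0 => gi.
have : g *+ 2 ^ j = 0 by rewrite -(subnKC ij) expnD mulrnA gi mul0rn.
by case: gj => -> /eqP; rewrite ?oppr_eq0.
Qed.

(* If p divides the denominator of x, then w = 1/x is divisible by p^2. Six doublings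
   give 4^6 w + O(w^2), whereas 64 P = P or - P. As 4^6 - 1 = 9 * 5 * 7 * 13, only
   p = 3 needs the coefficient of w^2, which is divisible by 3. *)
Lemma odd_torsion_int (W : weierstrass int) (T : zmodType)
    (f : T -> point rat) (g : T) (x y : rat) :
  embedding (map_weierstrass intr W) f -> f g = Affine x y ->
  g *+ 64 = g \/ g *+ 64 = - g -> x \is a Num.int.
Proof.
move=> ef eg g64; apply: int_zloc => p pp; apply: contraT => nx.
have c : on_curve (map_weierstrass intr W) (Affine x y).
  by case: (ef) => _ /(_ g); rewrite eg.
have [x0 [z zz xE]] := zloc_pole pp c nx.
have wz : x^-1 \in zloc p by rewrite xE rpredM ?rpred_nat.
have g0 : g != 0 by apply/eqP => h; move: eg; rewrite h (embedding0 ef).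
have nz i : (i <= 6)%N -> g *+ 2 ^ i != 0 by apply: (mul2n_neq0 (j := 6)).
have dbl i : g *+ 2 ^ i.+1 = g *+ 2 ^ i + g *+ 2 ^ i.
  by rewrite -mulrnDr addnn -mul2n expnS.
have zE := (rpredD, rpredN, rpredM, rpredX, rpred_int, rpred_nat, rpred1).
(* An opaque name keeps the powers of 4 from being computed. *)
have [pw pwE] : exists pw : nat -> rat, forall i, pw i = 4 ^+ i by eexists.
have pwS i : pw i.+1 = 4 * pw i by rewrite !pwE exprS.
have orbit i : (i <= 6)%N -> exists K x' y', [/\ K \in zloc p,
    12 * K = (pw i) ^+ 2 - pw i, f (g *+ 2 ^ i) = Affine x' y',
    x' \notin zloc p & exists2 c, c \in zloc p &
    x'^-1 = pw i * x^-1 + K * (b2 W)%:~R * x^-1 ^+ 2 + c * x^-1 ^+ 3].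
  elim: i => [_|i IH i6].
    exists 0, x, y; split; rewrite ?rpred0 ?pwE //.
    by exists 0; rewrite ?rpred0 ?pwE //; ring.
  have [K [x' [y' [Kz KE fE nx' xE']]]] := IH (ltnW i6).
  have Az : pw i \in zloc p by rewrite pwE !zE.
  have hh : g *+ 2 ^ i + g *+ 2 ^ i != 0 by rewrite -dbl nz.
  have [|x2 [y2 [fE2 nx2 [c2 c2z x2E]]]] :=
      zloc_double_step pp ef wz hh Az Kz; first by exists x', y'.
  exists (4 * K + (pw i) ^+ 2), x2, y2; split=> //.
  - by rewrite !zE.
  - by rewrite mulrDr mulrCA KE pwS; ring.
  - by rewrite dbl.
  by exists c2; rewrite // pwS.
have [N [k [c6 [NA kz c6z key]]]] : exists N k c6, [/\
    `|N|%N = (9 * (5 * (7 * 13)))%N, k \in zloc p, c6 \in zloc p &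
    N%:~R = - (3 * k * (b2 W)%:~R * x^-1 + c6 * x^-1 ^+ 2)].
  have [K [x6 [y6 [Kz KE e6 _ [c6 c6z x6E]]]]] := orbit 6 isT.
  have x6x : x6 = x.
    have {}e6 : f (g *+ 64) = Affine x6 y6 := e6.
    clear -ef eg g64 e6; case: g64 => g64; move: e6.
      by rewrite g64 eg => -[->].
    by rewrite g64 (embeddingN ef eg) => -[->].
  have [N [k [NA kz NE kE]]] := doubling_constants p.
  rewrite -(pwE 6) in NE kE; exists N, k, c6; split=> //; clear NA.
  move: KE x6E; rewrite x6x => /kE ->; rewrite NE => x6E.
  apply: (mulIf (x := x^-1)); first by rewrite invr_eq0.
  have -> : N%:~R * x^-1 = (N%:~R + 1) * x^-1 - x^-1 by ring.
  by rewrite {2}x6E; ring.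
have p1 := prime_gt1 pp.
have p0 : p%:R != 0 :> rat by rewrite pnatr_eq0; lia.
have d2 : (p ^ 2 %| `|N|)%N.
  apply: zloc_div => //.
  rewrite (_ : _ / _ = - (3 * k * (b2 W)%:~R * z
    + c6 * (p ^ 2)%:R * z ^+ 2)); first by rewrite !zE.
  by rewrite key xE natrX; field.
(* p^2 divides 9 * 5 * 7 * 13, in which 5, 7 and 13 occur once. *)
have p3 : p = 3%N.
  have : (p %| `|N|)%N by apply: dvdn_trans d2; rewrite dvdn_mulr.
  rewrite NA in d2 *; rewrite (_ : 9 = 3 * 3)%N // !Euclid_dvdM //.
  rewrite !dvdn_prime2 // orbb.
  by case/orP => [/eqP //|/or3P [] /eqP pE]; rewrite pE in d2.
(* As 1/x is divisible by 9, the b2 term is divisible by 27 and the remainder by 81, whereas N is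
   not divisible by 27. *)
have : (p ^ 3 %| `|N|)%N.
  apply: zloc_div => //.
  rewrite (_ : _ / _ = - (k * (b2 W)%:~R * z
    + c6 * p%:R * z ^+ 2)); first by rewrite !zE.
  by rewrite key xE p3 !natrX; field.
by rewrite p3 NA.
Qed.

(** If p divides the denominator of x, then p^2 divides 1/x and 4 = (4 x') (4/x + b2/x^2 + ...) is
    divisible by p, so p = 2; but then the right side is divisible by 8. The factor 4 admits an x'
    of order 2. *)
Lemma half_torsion_int (W : weierstrass int) (T : zmodType)
    (f : T -> point rat) (g : T) (x y x' y' : rat) :
  embedding (map_weierstrass intr W) f -> f g = Affine x y ->
  f (g + g) = Affine x' y' -> 4 * x' \is a Num.int -> x \is a Num.int.
Proof.
move=> ef eg egg x'i; apply: int_zloc => p pp; apply: contraT => nx.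
have c : on_curve (map_weierstrass intr W) (Affine x y).
  by case: (ef) => _ /(_ g); rewrite eg.
have [x0 [z zz xE]] := zloc_pole pp c nx.
have [F0 FE] := double_x ef eg egg.
have [nx' [u uz x'E]] := zloc_double pp nx F0 FE.
have [x'0 _] := zloc_inv pp nx'.
case/intrP: x'i => n nE.
have p1 := prime_gt1 pp.
have p0 : p%:R != 0 :> rat by rewrite pnatr_eq0; lia.
have zE := (rpredD, rpredN, rpredM, rpredX, rpred_int, rpred_nat, rpred1).
have key : (4 : int)%:~R = n%:~R * (4 * ((p ^ 2)%:R * z) + (b2 W)%:~R * ((p ^ 2)%:R * z) ^+ 2
    + u * ((p ^ 2)%:R * z) ^+ 3).
  by rewrite -xE -x'E -nE mulfK.
have p2 : p = 2%N.
  have : (p ^ 1 %| `|(4 : int)|)%N.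
    apply: zloc_div => //.
    rewrite (_ : _ / _ = n%:~R * p%:R * (4 * z + (b2 W)%:~R * (p ^ 2)%:R * z ^+ 2
      + u * (p ^ 4)%:R * z ^+ 3)); first by rewrite !zE.
    by rewrite key !natrX; field.
  by rewrite expn1 (_ : `|(4 : int)|%N = 2 ^ 2)%N // Euclid_dvdX // andbT
    dvdn_prime2 // => /eqP.
have : (p ^ 3 %| `|(4 : int)|)%N.
  apply: zloc_div => //.
  rewrite (_ : _ / _ = n%:~R * 2 * (z + (b2 W)%:~R * z ^+ 2
    + u * 4 * z ^+ 3)); first by rewrite !zE.
  by rewrite key p2 !natrX; field.
by rewrite p2.
Qed.


(** * Minimal models and Tate forms *)

Notation ratw W := (map_weierstrass intr W : weierstrass rat).

Definition minimal (W : weierstrass int) : Prop :=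
  disc W != 0 /\ forall W' : weierstrass int,
    isomorphic (ratw W) (ratw W') -> `|disc W| <= `|disc W'|.

Lemma minimal_shift (r s t : int) (W : weierstrass int) :
  minimal W -> minimal (shift r s t W).
Proof.
move=> [d0 m]; split=> [|W' h]; rewrite disc_shift //; apply: m.
by apply: isomorphic_trans h; rewrite map_shift; apply: isomorphic_shift.
Qed.

(** The change of variables with u = p divides the nonzero discriminant by p^12. *)
Lemma minimal_ndvd (p c1 c2 c3 c4 c6 : int) : 1 < p ->
  ~ minimal (Weierstrass (p * c1) (p ^+ 2 * c2) (p ^+ 3 * c3) (p ^+ 4 * c4)
               (p ^+ 6 * c6)).
Proof.
move=> p1 [d0 m].
have pq : p%:~R != 0 :> rat by rewrite intr_eq0; lia.
have dE : disc (Weierstrass (p * c1) (p ^+ 2 * c2) (p ^+ 3 * c3) (p ^+ 4 * c4)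
               (p ^+ 6 * c6)) = p ^+ 12 * disc (Weierstrass c1 c2 c3 c4 c6).
  by rewrite /disc /b8 /b6 /b4 /b2 /=; ring.
have /m : isomorphic (ratw (Weierstrass (p * c1) (p ^+ 2 * c2) (p ^+ 3 * c3)
    (p ^+ 4 * c4) (p ^+ 6 * c6))) (ratw (Weierstrass c1 c2 c3 c4 c6)).
  exists p%:~R, 0, 0, 0; split=> //.
  by rewrite /change_vars /map_weierstrass /=; congr Weierstrass; field.
rewrite dE in d0 *; apply/negP; rewrite -ltNge normrM.
have d1 : 0 < `|disc (Weierstrass c1 c2 c3 c4 c6)|.
  by rewrite normr_gt0; apply: contraNneq d0 => ->; rewrite mulr0.
rewrite ltr_pMl // ger0_norm ?exprn_ge0 ?exprn_egt1 //; lia.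
Qed.

Lemma embedding_on_curve (F : fieldType) (E : weierstrass F) (T : zmodType)
    (f : T -> point F) (g : T) (x y : F) : embedding E f ->
  f g = Affine x y -> on_curve E (Affine x y).
Proof. by case=> _ /(_ g) + _ eg; rewrite eg. Qed.

Lemma on_curve_int (W : weierstrass int) (x y : rat) :
  on_curve (ratw W) (Affine x y) -> x \is a Num.int -> y \is a Num.int.
Proof.
move=> /= h /intrP [n nE]; rewrite nE in h.
apply: (@int_root2 (a1 W * n + a3 W)
  (- (n ^+ 3 + a2 W * n ^+ 2 + a4 W * n + a6 W))).
rewrite !(rmorphN, rmorphD, rmorphM, rmorphXn) /= -h; ring.
Qed.

(* The shift moves [f g] to the origin and makes its tangent horizontal. *)
Lemma tate_form_field (F : fieldType) (E : weierstrass F) (T : zmodType)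
    (f : T -> point F) (g : T) (x y : F) :
  embedding E f -> f g = Affine x y -> g + g != 0 ->
  exists l A1 A2 A3 : F, shift x l y E = Weierstrass A1 A2 A3 0 0 /\
    [/\ embedding (Weierstrass A1 A2 A3 0 0) (move_point 1 x l y \o f),
        move_point 1 x l y (f g) = Affine 0 0 & exists y',
        f (g + g) = Affine (l ^+ 2 + a1 E * l - a2 E - x - x) y'].
Proof.
move=> ef eg gg; have [e0] := embedding_double ef eg gg.
set l := _ / _ => eg2.
have lE : l * (2 * y + a1 E * x + a3 E) =
    3 * x ^+ 2 + 2 * a2 E * x + a4 E - a1 E * y by rewrite mulfVK.
have c := embedding_on_curve ef eg.
exists l, (a1 (shift x l y E)), (a2 (shift x l y E)), (a3 (shift x l y E)).
have VE : shift x l y E = Weierstrass (a1 (shift x l y E))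
    (a2 (shift x l y E)) (a3 (shift x l y E)) 0 0.
  rewrite {1}/shift; congr Weierstrass.
    transitivity ((3 * x ^+ 2 + 2 * a2 E * x + a4 E - a1 E * y)
      - l * (2 * y + a1 E * x + a3 E)); first by ring.
    by rewrite lE subrr.
  transitivity ((x ^+ 3 + a2 E * x ^+ 2 + a4 E * x + a6 E)
    - (y ^+ 2 + a1 E * x * y + a3 E * y)); first by ring.
  by move: c => /= ->; rewrite subrr.
split=> //; rewrite -VE -change_vars1; split.
- exact: embedding_move (oner_neq0 _) ef.
- by rewrite eg /= subrr mulr0 subr0 subrr !mul0r.
by eexists; exact: eg2.
Qed.

(* The slope [l] is an integer: it satisfies a monic equation involving x(2P). *)
Lemma tate_form (W : weierstrass int) (T : zmodType) (f : T -> point rat)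
    (g : T) (x y x' y' : rat) :
  embedding (ratw W) f -> f g = Affine x y -> f (g + g) = Affine x' y' ->
  x \is a Num.int -> x' \is a Num.int ->
  exists r s t A1 A2 A3 : int, shift r s t W = Weierstrass A1 A2 A3 0 0 /\
    exists2 f' : T -> point rat,
      embedding (ratw (Weierstrass A1 A2 A3 0 0)) f' & f' g = Affine 0 0.
Proof.
move=> ef eg egg xi x'i.
have yi := on_curve_int (embedding_on_curve ef eg) xi.
have gg : g + g != 0.
  by apply/eqP => gg; move: egg; rewrite gg (embedding0 ef).
have [l [A1 [A2 [A3 [VE [ef' eg' [y2]]]]]]] := tate_form_field ef eg gg.
rewrite egg => -[x'E _].
case/intrP: xi => r rE; case/intrP: yi => t tE; case/intrP: x'i => r' rE'.
have /intrP [s sE] : l \is a Num.int.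
  apply: (@int_root2 (a1 W) (- (a2 W + 2 * r + r'))).
  rewrite [X in _ + X](_ : _ = - ((a2 W)%:~R + 2 * r%:~R + r'%:~R)); last by ring.
  by rewrite -rE -rE' x'E /=; ring.
have Vq : ratw (shift r s t W) = Weierstrass A1 A2 A3 0 0.
  by rewrite map_shift -rE -sE -tE.
exists r, s, t, (a1 (shift r s t W)), (a2 (shift r s t W)), (a3 (shift r s t W)).
set V := shift r s t W in Vq *.
have {}VE : V = Weierstrass (a1 V) (a2 V) (a3 V) 0 0.
  case: (V) Vq => B1 B2 B3 B4 B6 [_ _ _ /eqP e4 /eqP e6].
  by move: e4 e6; rewrite !intr_eq0 => /eqP -> /eqP ->.
by split=> //; exists (move_point 1 x l y \o f); rewrite -?VE ?Vq.
Qed.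

(** The middle relation is the transformation rule b2' = b2 + 12 r. *)
Lemma shift_rel (W : weierstrass int) (r s t A1 A2 A3 A4 A6 : int) :
  shift r s t W = Weierstrass A1 A2 A3 A4 A6 ->
  [/\ A1 = a1 W + 2 * s, A1 * A1 + 4 * A2 = a1 W * a1 W + 4 * a2 W + 12 * r
    & A3 = a3 W + r * a1 W + 2 * t].
Proof. by case=> <- <- <- _ _; split=> //; ring. Qed.

(** * Indices of reduced models; points of order 2 and 3 *)

Definition reduced (W : weierstrass int) : Prop :=
  [/\ a1 W \in [:: 0; 1], a3 W \in [:: 0; 1] & a2 W \in [:: -1; 0; 1]].

Definition has_index (W : weierstrass int) (l : seq nat) : bool :=
  has (fun i => (a1 W, a2 W, a3 W) == R i) l.

Lemma reduced_has_index (W : weierstrass int) (l : seq nat) : reduced W ->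
  (forall i, i \in iota 1 12 -> i \notin l -> 
     a1 W = (R i).1.1 -> a2 W = (R i).1.2 -> a3 W = (R i).2 -> False) ->
  has_index W l.
Proof.
case=> h1 h3 h2 H.
have /hasP [i i12 /eqP iE] : has_index W (iota 1 12).
  rewrite /has_index; move: h1 h2 h3; rewrite !inE.
  by do 2?[move=> /orP []]; do ?[case/orP|case/or3P|move/eqP=> ->].
have [il|il] := boolP (i \in l); first by apply/hasP; exists i; rewrite ?iE.
by case: (H i i12 il); rewrite -iE.
Qed.


(** Leaves one goal for each index outside the list, with the values of a1, a2, a3 named [i1], [i2],
    [i3]. *)
Ltac index_cases :=
  apply: reduced_has_index => // i; rewrite /iota !inE;
  repeat (case/orP => [/eqP -> //= _ i1 i2 i3|]); try (move/eqP => -> //= _ i1 i2 i3).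

Lemma order2_root (F : fieldType) (E : weierstrass F) (T : zmodType)
    (f : T -> point F) (g : T) (x y : F) : embedding E f ->
  f g = Affine x y -> g + g = 0 -> psi2 E x = 0.
Proof.
move=> ef eg gg; rewrite -(psi2_sqr (embedding_on_curve ef eg)).
by rewrite (embedding_order2 ef eg gg) expr0n.
Qed.

(** 16 [psi2] is a monic integral cubic in 4 x. *)
Lemma order2_x4_int (W : weierstrass int) (T : zmodType)
    (f : T -> point rat) (g : T) (x y : rat) : embedding (ratw W) f ->
  f g = Affine x y -> g + g = 0 -> 4 * x \is a Num.int.
Proof.
move=> ef eg gg; have := order2_root ef eg gg.
rewrite /psi2 b2_map b4_map b6_map => h.
apply: (@int_root3 (b2 W) (8 * b4 W) (16 * b6 W)).
rewrite -[RHS](mulr0 16) -[X in _ = _ * X]h !rmorphM /=; ring.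
Qed.

(** The excluded indices 2, 4, 6 are those with a1 = 0 and a3 = 1. There 2 [psi2] is a monic cubic
    in n = 2 x, Eisenstein at 2 with constant term 2 (1 + 4 a6), so it has no root. *)
Lemma order2_index (W : weierstrass int) (T : zmodType) (f : T -> point rat)
    (g : T) : reduced W -> embedding (ratw W) f -> g != 0 -> g + g = 0 ->
  has_index W [:: 1; 3; 5; 7; 8; 9; 10; 11; 12]%N.
Proof.
move=> red ef g0 gg; have [x [y eg]] := embedding_affine ef g0.
suff H : a1 W = 0 -> a3 W = 1 -> False by index_cases; apply: H.
move=> e1 e3; have := order2_root ef eg gg.
rewrite /psi2 b2_map b4_map b6_map /b2 /b4 /b6 e1 e3 => h.
have /intrP [n nE] : 2 * x \is a Num.int.
  apply: (@int_root3 (2 * a2 W) (4 * a4 W) (2 * (1 + 4 * a6 W))).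
  rewrite -[RHS](mulr0 2) -[X in _ = _ * X]h; ring.
have : n ^+ 3 + 2 * a2 W * n ^+ 2 + 4 * a4 W * n + 2 * (1 + 4 * a6 W) = 0.
  apply: (@intr_inj rat); rewrite -[RHS](mulr0 2) -[X in _ = _ * X]h.
  have -> : x = n%:~R / 2 by rewrite -nE; field.
  by field.
have [m [->|->]] : exists m : int, n = 2 * m \/ n = 2 * m + 1.
- by exists (n %/ 2)%Z; lia.
- by rewrite !expr2 !exprS expr0; lia.
- by rewrite !exprS expr0; lia.
Qed.

(** A point of order 3 is a flex: x(2P) = x(P) reads l^2 + a1 l - a2 = 3 x for the tangent slope l,
    and the square is completed. *)
Lemma order3_slope (F : fieldType) (E : weierstrass F) (T : zmodType)
    (f : T -> point F) (g : T) (x y : F) : embedding E f ->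
  f g = Affine x y -> g != 0 -> g *+ 3 = 0 -> exists l : F,
  (a1 E + 2 * l) ^+ 2 = b2 E + 12 * x.
Proof.
move=> ef eg g0 g3.
have g2 : g + g = - g by apply/eqP; rewrite -addr_eq0 -g3 !mulrS mulr0n addr0 addrA.
have gg : g + g != 0 by rewrite g2 oppr_eq0.
have [e0] := embedding_double ef eg gg; rewrite g2 (embeddingN ef eg) /=.
set l := _ / _ => -[xE _]; exists l.
by rewrite [12 * x](_ : _ = 8 * x + 4 * x); [rewrite {2}xE /b2|]; ring.
Qed.

Lemma odd_order_int (W : weierstrass int) (T : zmodType)
    (f : T -> point rat) (g : T) (x y : rat) (n : nat) :
  embedding (ratw W) f -> f g = Affine x y -> g *+ n = 0 ->
  (n %| 63)%N || (n %| 65)%N -> x \is a Num.int.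
Proof.
move=> ef eg gn /orP [] /dvdnP [k kE]; apply: (odd_torsion_int ef eg).
  by left; rewrite (_ : 64 = 63 + 1)%N // mulrnDr kE mulnC mulrnA gn mul0rn add0r.
right; apply/eqP; rewrite -addr_eq0 -mulrSr.
by rewrite [65%N]kE mulnC mulrnA gn mul0rn.
Qed.

Lemma order3_b2 (W : weierstrass int) (T : zmodType) (f : T -> point rat)
    (g : T) : embedding (ratw W) f -> g != 0 -> g *+ 3 = 0 ->
  exists k m : int, a1 W * a1 W + 4 * a2 W + 12 * m = k * k.
Proof.
move=> ef g0 g3; have [x [y eg]] := embedding_affine ef g0.
have /intrP [m mE] := odd_order_int ef eg g3 isT.
have [l] := order3_slope ef eg g0 g3; rewrite b2_map mE => h.
have /intrP [k kE] : (a1 W)%:~R + 2 * l \is a Num.int.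
  apply: (@int_root2 0 (- (b2 W + 12 * m))).
  rewrite [LHS](_ : _ = ((a1 W)%:~R + 2 * l) ^+ 2 - ((b2 W)%:~R + 12 * m%:~R)).
    by rewrite -h subrr.
  by ring.
exists k, m; apply: (@intr_inj rat).
move: h => /=; rewrite kE => h.
by rewrite [RHS](_ : _ = k%:~R ^+ 2); [rewrite h /b2|]; ring.
Qed.

Lemma int_mod2 (n : int) : exists m : int, n = 2 * m \/ n = 2 * m + 1.
Proof. by exists (n %/ 2)%Z; lia. Qed.

Lemma int_mod3 (n : int) :
  exists m : int, [\/ n = 3 * m, n = 3 * m + 1 | n = 3 * m - 1].
Proof.
exists ((n + 1) %/ 3)%Z; set q := ((n + 1) %/ 3)%Z.
have [] : n = 3 * q \/ n = 3 * q + 1 \/ n = 3 * q - 1 by rewrite /q; lia.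
  by constructor 1.
by case; [constructor 2|constructor 3].
Qed.

(** b2 is a square modulo 3, so a1^2 + a2 is not 2 modulo 3; this removes the indices 3, 4, 11,
    12. *)
Lemma order3_index (W : weierstrass int) (T : zmodType) (f : T -> point rat)
    (g : T) : reduced W -> embedding (ratw W) f -> g != 0 -> g *+ 3 = 0 ->
  has_index W [:: 1; 2; 5; 6; 7; 8; 9; 10]%N.
Proof.
move=> red ef g0 g3; have [k [m E]] := order3_b2 ef g0 g3.
have [q qE] := int_mod3 k.
by index_cases; move: E; rewrite i1 i2; case: qE => ->; lia.
Qed.

(* The chords through P and 2P, 3P have slopes e and -(c + d), which satisfy monic
   equations involving x(3P), x(4P). *)
Lemma tate_mult2 (F : fieldType) (A1 A2 A3 : F) (T : zmodType)
    (f : T -> point F) (g : T) :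
  embedding (Weierstrass A1 A2 A3 0 0) f -> f g = Affine 0 0 -> g *+ 2 != 0 ->
  A3 != 0 /\ f (g *+ 2) = Affine (- A2) (A1 * A2 - A3).
Proof.
move=> ef eg g2; have [/= e0] := embedding_double ef eg g2.
rewrite [2 * 0 + A1 * 0 + A3](_ : _ = A3) in e0 *; last by ring.
rewrite /= !(mulr0, mul0r, expr0n, addr0, subr0, add0r) /= -mulr2n => ->.
by split=> //; congr Affine; ring.
Qed.

(** Here c = A3 / A2. The slope e may vanish: as x(3P) = c e, this happens when 3P = - P, the case
    of order 4. *)
Lemma tate_mult3 (F : fieldType) (A1 A2 A3 : F) (T : zmodType)
    (f : T -> point F) (g : T) :
  embedding (Weierstrass A1 A2 A3 0 0) f -> f g = Affine 0 0 ->
  g *+ 2 != 0 -> g *+ 3 != 0 ->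
  exists c e : F, [/\ A1 = c - e, A3 = c * A2, A2 != 0, c != 0
    & f (g *+ 3) = Affine (c * e) (- c * (c * e + A2))].
Proof.
move=> ef eg g2 g3; have [A30 eg2] := tate_mult2 ef eg g2.
have n1 : g *+ 2 != g.
  rewrite -subr_eq0 -[X in _ - X]mulr1n -mulrnBr //.
  by apply: contraNneq g2; rewrite mulr1n => ->; rewrite mul0rn.
have n2 : g *+ 2 != - g by rewrite -addr_eq0 -mulrSr.
have [/=] := embedding_chord ef eg eg2 n1 n2; rewrite -mulrS subr0 => A20.
have {}A20 : A2 != 0 by rewrite -oppr_eq0.
move=> ->; exists (A3 / A2), (A3 / A2 - A1); split=> //; try by field.
  by rewrite mulf_neq0 ?invr_eq0.
by congr Affine; field; rewrite ?oppr_eq0 A20.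
Qed.

Lemma tate_mult4 (F : fieldType) (A1 A2 A3 : F) (T : zmodType)
    (f : T -> point F) (g : T) :
  embedding (Weierstrass A1 A2 A3 0 0) f -> f g = Affine 0 0 ->
  g *+ 2 != 0 -> g *+ 3 != 0 -> g *+ 4 != 0 ->
  exists c d e : F, [/\ A1 = c - e, A2 = d * e, A3 = c * (d * e),
    [/\ c != 0, d != 0 & e != 0]
    & f (g *+ 3) = Affine (c * e) (- c * (c * e + d * e)) /\
      f (g *+ 4) = Affine (d * (c + d)) (d ^+ 2 * (c + d + e))].
Proof.
move=> ef eg g2 g3 g4; have [c [e [A1E A3E A20 c0 eg3]]] := tate_mult3 ef eg g2 g3.
have n1 : g *+ 3 != g.
  by rewrite -subr_eq0 -[X in _ - X]mulr1n -mulrnBr //.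
have n2 : g *+ 3 != - g by rewrite -addr_eq0 -mulrSr.
have [/=] := embedding_chord ef eg eg3 n1 n2; rewrite -mulrS subr0.
rewrite mulf_eq0 negb_or => /andP [_ e0] eg4.
exists c, (A2 / e), e; rewrite divfK //; split=> //.
  by split=> //; rewrite mulf_neq0 ?invr_eq0.
by split=> //; rewrite eg4 A3E A1E; congr Affine; field; rewrite c0 e0.
Qed.

(** The chord through P and 4P has slope d + k. *)
Lemma tate_mult5 (F : fieldType) (c d e : F) (T : zmodType)
    (f : T -> point F) (g : T) :
  embedding (Weierstrass (c - e) (d * e) (c * (d * e)) 0 0) f ->
  f g = Affine 0 0 -> 
  f (g *+ 4) = Affine (d * (c + d)) (d ^+ 2 * (c + d + e)) ->
  g *+ 3 != 0 -> g *+ 5 != 0 ->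
  c + d != 0 /\ 
  let k := d * e / (c + d) in exists y, f (g *+ 5) = Affine (k * (k - c - e)) y.
Proof.
move=> ef eg eg4 g3 g5.
have n1 : g *+ 4 != g.
  by rewrite -subr_eq0 -[X in _ - X]mulr1n -mulrnBr //.
have n2 : g *+ 4 != - g by rewrite -addr_eq0 -mulrSr.
have [/=] := embedding_chord ef eg eg4 n1 n2; rewrite -mulrS subr0.
rewrite mulf_eq0 negb_or => /andP [d0 cd0] ->; split=> //.
by eexists; congr Affine; field; rewrite cd0 d0.
Qed.


(** * Points of a given order *)

(* [a1], [a2], [a3] of the reduced model are recovered modulo 2, 3, 2 from
   those of any integral translate. *)
Lemma shift_congr (W : weierstrass int) (r s t A1 A2 A3 A4 A6 : int) :
  reduced W -> shift r s t W = Weierstrass A1 A2 A3 A4 A6 ->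
  [/\ exists k, A1 = a1 W + 2 * k,
      exists k, A1 * A1 + 4 * A2 = a1 W + a2 W + 3 * k,
      a1 W = 0 -> exists k, A3 = a3 W + 2 * k
    & a1 W = 1 -> exists k, A3 - A2 = a3 W - a2 W + 2 * k].
Proof.
move=> [h1 _ _] /shift_rel [E1 E2 E3]; split.
- by exists s.
- exists (a2 W + 4 * r); rewrite E2; move: h1; rewrite !inE.
  by case/orP => /eqP ->; ring.
- by move=> e1; exists t; rewrite E3 e1; ring.
move=> e1; rewrite e1 in E1 E2 E3.
(* For a1 = 1 the parity of A3 alone varies with r, but A3 - A2 = a3 - a2 + s (s + 1) + 2 (t -
   r). *)
have [k kE] : exists k, s * (s + 1) = 2 * k.
  by have [q [->|->]] := int_mod2 s; [exists (q * (2 * q + 1))|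
    exists ((2 * q + 1) * (q + 1))]; ring.
exists (t - r + k).
have : A1 * A1 = 4 * (s * (s + 1)) + 1 by rewrite E1; ring.
by rewrite kE; lia.
Qed.

Lemma has_index_sub (W : weierstrass int) (l l' : seq nat) :
  has_index W l -> all (mem l') l -> has_index W l'.
Proof.
by move=> /hasP [i il iE] /allP ll; apply/hasP; exists i; rewrite // [_ \in _]ll.
Qed.

Lemma R_inj : {in iota 1 12 &, injective R}.
Proof.
have /allP H : all (fun i => all (fun j => (R i == R j) ==> (i == j))
  (iota 1 12)) (iota 1 12) by [].
by move=> i j /H /allP Hi /Hi /implyP Hij /eqP /Hij /eqP.
Qed.

Lemma has_index_inter (W : weierstrass int) (l1 l2 : seq nat) :
  has_index W l1 -> has_index W l2 -> all (mem (iota 1 12)) l1 ->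
  all (mem (iota 1 12)) l2 -> has_index W [seq i <- l1 | i \in l2].
Proof.
move=> /hasP [i i1 /eqP iE] /hasP [j j2 /eqP jE] /allP h1 /allP h2.
have ij : i = j by apply: (R_inj (h1 _ i1) (h2 _ j2)); rewrite -iE.
by apply/hasP; exists i; rewrite ?iE // mem_filter i1 {1}ij j2.
Qed.

(** Indices 7, 10, 12 are those with a1 = 1 and a2, a3 of equal parity. *)
Lemma index_odd (W : weierstrass int) (r s t A1 A2 A3 A4 A6 : int) :
  reduced W -> shift r s t W = Weierstrass A1 A2 A3 A4 A6 ->
  (forall k, A1 <> 2 * k) -> (forall k, A3 - A2 <> 2 * k + 1) ->
  has_index W [:: 7; 10; 12]%N.
Proof.
move=> red /(shift_congr red) [[k1 E1] _ _ E4] H1 H3.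
index_cases; rewrite i1 ?i2 ?i3 in E1 E4; try by apply: (H1 k1); lia.
all: have [k E] := E4 erefl; first [apply: (H3 k); lia|apply: (H3 (k - 1)); lia].
Qed.

Lemma index_even (W : weierstrass int) (r s t A1 A2 A3 A4 A6 : int) :
  reduced W -> shift r s t W = Weierstrass A1 A2 A3 A4 A6 ->
  (forall k, A1 <> 2 * k + 1) -> has_index W [:: 1; 2; 3; 4; 5; 6]%N.
Proof.
move=> red /(shift_congr red) [[k1 E1] _ _ _] H1.
by index_cases; rewrite i1 in E1; apply: (H1 k1); lia.
Qed.

Lemma index_even_odd (W : weierstrass int) (r s t A1 A2 A3 A4 A6 : int) :
  reduced W -> shift r s t W = Weierstrass A1 A2 A3 A4 A6 ->
  (forall k, A1 <> 2 * k + 1) -> (forall k, A3 <> 2 * k) ->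
  has_index W [:: 2; 4; 6]%N.
Proof.
move=> red /(shift_congr red) [[k1 E1] _ E3 _] H1 H3.
index_cases; rewrite i1 ?i3 in E1 E3; try by apply: (H1 k1); lia.
all: by have [k E] := E3 erefl; apply: (H3 k); lia.
Qed.

(** Modulo 3, b2 is a1 + a2 because a1 is 0 or 1. The value 0 belongs to the indices 1, 2, 9, 10,
    and the value 2 to 3, 4, 11, 12. *)
Lemma index_mod3_neq0 (W : weierstrass int) (r s t A1 A2 A3 A4 A6 : int) :
  reduced W -> shift r s t W = Weierstrass A1 A2 A3 A4 A6 ->
  (forall k, A1 * A1 + 4 * A2 <> 3 * k) ->
  has_index W [:: 3; 4; 5; 6; 7; 8; 11; 12]%N.
Proof.
move=> red /(shift_congr red) [_ [k E] _ _] H.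
index_cases; rewrite i1 i2 in E; first [apply: (H k); lia|apply: (H (k - 1)); lia].
Qed.

Lemma index_mod3_neq2 (W : weierstrass int) (r s t A1 A2 A3 A4 A6 : int) :
  reduced W -> shift r s t W = Weierstrass A1 A2 A3 A4 A6 ->
  (forall k, A1 * A1 + 4 * A2 <> 3 * k + 2) ->
  has_index W [:: 1; 2; 5; 6; 7; 8; 9; 10]%N.
Proof.
move=> red /(shift_congr red) [_ [k E] _ _] H.
index_cases; rewrite i1 i2 in E; first [apply: (H k); lia|apply: (H (k - 1)); lia].
Qed.

(** A1, A2, A3 are homogeneous of degrees 1, 2, 3 in c, d, e. *)
Lemma tate_ndvd (p c d e : int) : 1 < p ->
  ~ minimal (Weierstrass (p * c - p * e) (p * d * (p * e))
       (p * c * (p * d * (p * e))) 0 0).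
Proof.
move=> p1 m; apply: (@minimal_ndvd p (c - e) (d * e) (c * (d * e)) 0 0 p1).
rewrite !mulr0 mulrBr (_ : p ^+ 2 * (d * e) = p * d * (p * e)); last by ring.
by rewrite (_ : p ^+ 3 * _ = p * c * (p * d * (p * e))); last by ring.
Qed.

Lemma odd_order_tate (W : weierstrass int) (T : zmodType) (f : T -> point rat)
    (g : T) (n : nat) : embedding (ratw W) f -> g *+ n = 0 ->
  (n %| 63)%N || (n %| 65)%N ->
  g != 0 -> g *+ 2 != 0 -> g *+ 3 != 0 -> g *+ 4 != 0 ->
  exists r s t c d e : int, 
    [/\ shift r s t W = Weierstrass (c - e) (d * e) (c * (d * e)) 0 0,
        c != 0, d != 0, e != 0 & exists2 f' : T -> point rat,
      embedding (Weierstrass (c%:~R - e%:~R) (d%:~R * e%:~R)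
                   (c%:~R * (d%:~R * e%:~R)) 0 0) f' &
      [/\ f' g = Affine 0 0,
        exists y, f' (g *+ 3) = Affine (c%:~R * e%:~R) y &
        f' (g *+ 4) = Affine (d%:~R * (c%:~R + d%:~R))
                             (d%:~R ^+ 2 * (c%:~R + d%:~R + e%:~R))]].
Proof.
move=> ef gn n63 g1 g2 g3 g4.
have kn k : g *+ k *+ n = 0 by rewrite mulrnAC gn mul0rn.
have [x [y eg]] := embedding_affine ef g1.
have [x2 [y2 eg2]] := embedding_affine ef g2.
have xi := odd_order_int ef eg gn n63.
have x2i := odd_order_int ef eg2 (kn 2) n63.
have [r [s [t [A1 [A2 [A3 [VE [f' ef' eg']]]]]]]] :=
  tate_form ef eg eg2 xi x2i.
have [c [d [e [A1E A2E A3E [c0 d0 e0] [eg3 eg4]]]]] :=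
  tate_mult4 ef' eg' g2 g3 g4.
have /intrP [X3 X3E] := odd_order_int ef' eg3 (kn 3) n63.
have /intrP [X4 X4E] := odd_order_int ef' eg4 (kn 4) n63.
have /intrP [ci cE] : c \is a Num.int.
  apply: (@int_root2 (- A1) (- X3)); rewrite !rmorphN /= -X3E.
  by rewrite A1E; ring.
have /intrP [di dE] : d \is a Num.int.
  apply: (@int_root2 ci (- X4)); rewrite !rmorphN /= -X4E -cE; ring.
pose ei := ci - A1.
have eE : e = ei%:~R by rewrite /ei rmorphB /= -cE A1E; ring.
clearbody ei.
rewrite cE dE eE in c0 d0 e0 A1E A2E A3E eg3 eg4.
rewrite !intr_eq0 in c0 d0 e0.
exists r, s, t, ci, di, ei; split=> //.
  rewrite VE; congr Weierstrass; apply: (@intr_inj rat).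
  - by rewrite A1E rmorphB.
  - by rewrite A2E rmorphM.
  by rewrite A3E !rmorphM.
exists f'; last by split=> //; eexists; exact: eg3.
by move: ef'; rewrite /map_weierstrass /= A1E A2E A3E.
Qed.

Lemma mulrn_coprime_neq0 (T : zmodType) (g : T) (k n : nat) :
  g != 0 -> g *+ n = 0 -> (0 < k)%N -> coprime k n -> g *+ k != 0.
Proof.
move=> g0 gn k0 /eqP kn; apply: contraNneq g0 => gk.
case: (egcdnP n k0) => u v uv _; have := congr1 (GRing.natmul g) uv.
rewrite kn mulrnDr (mulnC u) (mulrnA g k) gk (mulnC v) (mulrnA g n) gn.
by rewrite !mul0rn add0r mulr1n => <-.
Qed.

Lemma mulrn_opp (T : zmodType) (g : T) (k n : nat) :
  g *+ (k + n) = 0 -> g *+ k = - (g *+ n).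
Proof. by move=> /eqP; rewrite mulrnDr addr_eq0 => /eqP. Qed.

(** Stated apart from [order5_index] because order 10 uses the embedding into this Tate form as
    well. *)
Lemma order5_tate (W : weierstrass int) (T : zmodType) (f : T -> point rat)
    (g : T) : embedding (ratw W) f -> g != 0 -> g *+ 5 = 0 ->
  exists r s t d e : int,
    shift r s t W = Weierstrass (- d - e) (d * e) (- d * (d * e)) 0 0 /\
    exists f' : T -> point rat,
      embedding (ratw (Weierstrass (- d - e) (d * e) (- d * (d * e)) 0 0)) f'.
Proof.
move=> ef g0 g5; have nz := mulrn_coprime_neq0 g0 g5.
have [r [s [t [c [d [e [VE c0 d0 e0 [f' ef' [eg' _ eg4]]]]]]]]] :=
  odd_order_tate ef g5 isT g0 (nz 2 isT isT) (nz 3 isT isT) (nz 4 isT isT).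
have {eg4 eg'} cd : c = - d.
  have := embeddingN ef' eg'; rewrite -(mulrn_opp (k := 4) (n := 1)) // eg4.
  move=> [/eqP h _]; move: h; rewrite -rmorphD -rmorphM intr_eq0 mulf_eq0.
  by rewrite (negPf d0) addr_eq0 => /eqP.
rewrite {}cd in VE ef'; exists r, s, t, d, e; split=> //; exists f'.
by move: ef'; rewrite /map_weierstrass /= !(rmorphB, rmorphM) !rmorphN.
Qed.

Lemma order5_index (W : weierstrass int) (T : zmodType) (f : T -> point rat)
    (g : T) : reduced W -> minimal W -> embedding (ratw W) f ->
  g != 0 -> g *+ 5 = 0 -> has_index W [:: 4; 6; 7; 12]%N.
Proof.
move=> red m ef g0 g5.
have [r [s [t [d [e [VE _]]]]]] := order5_tate ef g0 g5.
have n2 i j : d = 2 * i -> e = 2 * j -> False.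
  move=> dE eE; have := minimal_shift r s t m; rewrite VE dE eE -mulrN.
  exact: tate_ndvd.
have n3 i j : d = 3 * i -> e = 3 * j -> False.
  move=> dE eE; have := minimal_shift r s t m; rewrite VE dE eE -mulrN.
  exact: tate_ndvd.
have [d' d2] := int_mod2 d; have [e' e2] := int_mod2 e.
have [d3 D3] := int_mod3 d; have [e3 D3'] := int_mod3 e.
(* (d + e)^2 + 4 d e is d^2 + e^2 modulo 3, which vanishes only if 3 divides both. *)
have I3 : has_index W [:: 3; 4; 5; 6; 7; 8; 11; 12]%N.
  apply: index_mod3_neq0 red VE _ => k.
  by case: D3 => D3; case: D3' => D3'; rewrite D3 D3'; [case: (n3 _ _ D3 D3')|lia..].
have I2 : has_index W [:: 2; 4; 6; 7; 10; 12]%N.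
  case: d2 => d2; case: e2 => e2; rewrite d2 e2 in VE.
  - by case: (n2 _ _ d2 e2).
  - by apply: has_index_sub (index_odd red VE _ _) _ => // k; lia.
  - by apply: has_index_sub (index_odd red VE _ _) _ => // k; lia.
  - by apply: has_index_sub (index_even_odd red VE _ _) _ => // k; lia.
exact: has_index_inter I2 I3 isT isT.
Qed.


Lemma order7_index (W : weierstrass int) (T : zmodType) (f : T -> point rat)
    (g : T) : reduced W -> minimal W -> embedding (ratw W) f ->
  g != 0 -> g *+ 7 = 0 -> has_index W [:: 7; 10]%N.
Proof.
move=> red m ef g0 g7.
have nz := mulrn_coprime_neq0 g0 g7.
have [r [s [t [c [d [e [VE c0 d0 e0 [f' ef' [eg' [y eg3] eg4]]]]]]]]] :=
  odd_order_tate ef g7 isT g0 (nz 2 isT isT) (nz 3 isT isT) (nz 4 isT isT).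
have {eg3 eg4 ef' eg'} E : d * (c + d) = c * e.
  have := embeddingN ef' eg3; rewrite -(mulrn_opp (k := 4) (n := 3)) // eg4.
  by move=> [/eqP h _]; apply/eqP; rewrite -(eqr_int rat) !rmorphM rmorphD.
have n2 i j k : c = 2 * i -> d = 2 * j -> e = 2 * k -> False.
  move=> cE dE eE; have := minimal_shift r s t m; rewrite VE cE dE eE.
  exact: tate_ndvd.
have n3 i j k : c = 3 * i -> d = 3 * j -> e = 3 * k -> False.
  move=> cE dE eE; have := minimal_shift r s t m; rewrite VE cE dE eE.
  exact: tate_ndvd.
(* If c = e modulo 2, the relation becomes d (c + d) = c, which forces c, d, e even. If d e (c - 1)
   were odd, then c = 0 and d = e = 1 modulo 2, against the relation. *)
have I2 : has_index W [:: 7; 10; 12]%N.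
  have [c' c2] := int_mod2 c; have [d' d2] := int_mod2 d.
  have [e' e2] := int_mod2 e.
  have [h1 h2] : (forall k, c - e <> 2 * k) /\
      (forall k, c * (d * e) - d * e <> 2 * k + 1).
    case: c2 => c2; case: d2 => d2; case: e2 => e2;
      [by case: (n2 _ _ _ c2 d2 e2)|..];
      (move: E; rewrite c2 d2 e2; clear; split=> k; lia).
  exact: index_odd red VE h1 h2.
have I3 : has_index W [:: 1; 2; 5; 6; 7; 8; 9; 10]%N.
  apply: index_mod3_neq2 red VE _ => k h.
  have [c' c3] := int_mod3 c; have [d' d3] := int_mod3 d.
  have [e' e3] := int_mod3 e.
  case: c3 => c3; case: d3 => d3; case: e3 => e3;
      [by case: (n3 _ _ _ c3 d3 e3)|..];
      (move: E h; rewrite c3 d3 e3; clear; lia).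
exact: has_index_inter I2 I3 isT isT.
Qed.

Lemma order9_index (W : weierstrass int) (T : zmodType) (f : T -> point rat)
    (g : T) : reduced W -> minimal W -> embedding (ratw W) f ->
  g *+ 3 != 0 -> g *+ 9 = 0 -> has_index W [:: 7; 10]%N.
Proof.
move=> red m ef g3 g9.
have g0 : g != 0 by apply: contraNneq g3 => ->; rewrite mul0rn.
have nz := mulrn_coprime_neq0 g0 g9.
have [r [s [t [c [d [e [VE c0 d0 e0 [f' ef' [eg' [y eg3] eg4]]]]]]]]] :=
  odd_order_tate ef g9 isT g0 (nz 2 isT isT) g3 (nz 4 isT isT).
have [cd [y' eg5]] := tate_mult5 ef' eg' eg4 g3 (nz 5 isT isT).
set k := _ / _ in eg5.
have kE : k * (c%:~R + d%:~R) = d%:~R * e%:~R by rewrite mulfVK.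
have E4 : k * (k - c%:~R - e%:~R) = d%:~R * (c%:~R + d%:~R).
  have := embeddingN ef' eg4; rewrite -(mulrn_opp (k := 5) (n := 4)) // eg5.
  by case.
(* 5P = - 4P equates x(5P) and x(4P), a monic quadratic equation for k. *)
have /intrP [n nE] : k \is a Num.int.
  apply: (@int_root2 (- (c + e)) (- (d * (c + d)))).
  rewrite !rmorphN rmorphM !rmorphD /= -E4; clear; ring.
have E1 : n * (c + d) = d * e.
  by apply/eqP; rewrite -(eqr_int rat) !rmorphM rmorphD /= -nE kE.
have E2 : n * (n - c - e) = d * (c + d).
  by apply/eqP; rewrite -(eqr_int rat) !(rmorphM, rmorphD, rmorphN) /= -nE E4.
have n0 : n != 0.
  have : n * (c + d) != 0 by rewrite E1 mulf_neq0.
  by rewrite mulf_eq0 negb_or => /andP [].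
(* [E2] times e with n cancelled by means of [E1]. Modulo 2 it excludes n = d = 0, c = e = 1, which
   satisfies [E1] and [E2]. *)
have E3 : e * (n - c - e) = (c + d) * (c + d).
  apply: (mulfI n0); rewrite mulrCA E2 !mulrA E1; clear; ring.
have n2 i j l : c = 2 * i -> d = 2 * j -> e = 2 * l -> False.
  move=> cE dE eE; have := minimal_shift r s t m; rewrite VE cE dE eE.
  exact: tate_ndvd.
have I2 : has_index W [:: 7; 10; 12]%N.
  have [c' c2] := int_mod2 c; have [d' d2] := int_mod2 d.
  have [e' e2] := int_mod2 e; have [n' N2] := int_mod2 n.
  have [h1 h2] : (forall k, c - e <> 2 * k) /\
      (forall k, c * (d * e) - d * e <> 2 * k + 1).
    case: c2 => c2; case: d2 => d2; case: e2 => e2;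
      [by case: (n2 _ _ _ c2 d2 e2)|..];
      (move: E1 E2 E3; case: N2 => ->; rewrite c2 d2 e2; clear;
      split=> ?; lia).
  exact: index_odd red VE h1 h2.
have I3 : has_index W [:: 1; 2; 5; 6; 7; 8; 9; 10]%N.
  by apply: (order3_index red ef g3); rewrite -mulrnA.
exact: has_index_inter I2 I3 isT isT.
Qed.


(** * Points of order 4, 8 and 10 *)

Lemma order4_int (W : weierstrass int) (T : zmodType) (f : T -> point rat)
    (g : T) (x y : rat) : embedding (ratw W) f -> f g = Affine x y ->
  g *+ 2 != 0 -> g *+ 4 = 0 -> x \is a Num.int.
Proof.
move=> ef eg g2 g4; have [x' [y' eg2]] := embedding_affine ef g2.
have x4 : 4 * x' \is a Num.int.
  by apply: order2_x4_int ef eg2 _; rewrite -mulrnDr.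
by rewrite mulr2n in eg2; apply: half_torsion_int ef eg eg2 x4.
Qed.

Lemma order8_int (W : weierstrass int) (T : zmodType) (f : T -> point rat)
    (g : T) (x y : rat) : embedding (ratw W) f -> f g = Affine x y ->
  g *+ 4 != 0 -> g *+ 8 = 0 -> x \is a Num.int.
Proof.
move=> ef eg g4 g8.
have g2 : g *+ 2 != 0.
  by apply: contraNneq g4 => g2; rewrite (mulrnA g 2 2) g2 mul0rn.
have [x' [y' eg2]] := embedding_affine ef g2.
have x'i : x' \is a Num.int by apply: order4_int ef eg2 _ _; rewrite -mulrnA.
rewrite mulr2n in eg2; apply: half_torsion_int ef eg eg2 _.
by rewrite rpredM ?rpred_nat.
Qed.

Lemma order8_index (W : weierstrass int) (T : zmodType) (f : T -> point rat)
    (g : T) : reduced W -> minimal W -> embedding (ratw W) f ->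
  g *+ 4 != 0 -> g *+ 8 = 0 -> has_index W [:: 3; 5; 7; 12]%N.
Proof.
move=> red m ef g4 g8.
have g1 : g != 0 by apply: contraNneq g4 => ->; rewrite mul0rn.
have g2 : g *+ 2 != 0.
  by apply: contraNneq g4 => g2; rewrite (mulrnA g 2 2) g2 mul0rn.
have g3 := mulrn_coprime_neq0 (k := 3) g1 g8 isT isT.
have [x [y eg]] := embedding_affine ef g1.
have [x2 [y2 eg2]] := embedding_affine ef g2.
have xi := order8_int ef eg g4 g8.
have x2i : x2 \is a Num.int by apply: order4_int ef eg2 _ _; rewrite -mulrnA.
have [r [s [t [A1 [A2 [A3 [VE [f' ef' eg']]]]]]]] :=
  tate_form ef eg eg2 xi x2i.
have [c [d [e [A1E A2E A3E [c0 d0 e0] [eg3 eg4]]]]] :=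
  tate_mult4 ef' eg' g2 g3 g4.
rewrite /= in A1E A2E A3E.
have /intrP [X3 X3E] : c * e \is a Num.int.
  apply: order8_int ef' eg3 _ _; last by rewrite mulrnAC g8 mul0rn.
  by rewrite -mulrnA (mulrnDr g 4 8) g8 addr0.
have g44 : g *+ 4 + g *+ 4 = 0 by rewrite -mulrnDr.
have /intrP [X4 X4E] := order2_x4_int ef' eg4 g44.
have E8 := embedding_order2 ef' eg4 g44; rewrite /= A1E A3E in E8.
have /intrP [ci cE] : c \is a Num.int.
  apply: (@int_root2 (- A1) (- X3)); rewrite !rmorphN /= -X3E.
  by rewrite A1E; ring.
(* 4P has order 2, so only 4 x(4P) = D (D + 2 c) is known to be integral, where D = 2 d. *)
have /intrP [D DE] : 2 * d \is a Num.int.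
  apply: (@int_root2 (2 * ci) (- X4)); rewrite !rmorphN /= -X4E.
  by rewrite rmorphM /= -cE; ring.
pose ei := ci - A1.
have eE : e = ei%:~R by rewrite /ei rmorphB /= -cE A1E; ring.
have A1i : A1 = ci - ei by rewrite /ei; ring.
clearbody ei.
have A2i : 2 * A2 = D * ei.
  by apply: (@intr_inj rat); rewrite !rmorphM /= A2E -DE eE; ring.
have A3i : A3 = ci * A2.
  by apply: (@intr_inj rat); rewrite rmorphM /= A3E A2E -cE.
(* Twice the order 2 condition at 4P, divided by d. *)
have E : (ci + D) * (2 * ci + D) + D * ei = 0.
  apply: (@intr_inj rat); rewrite !(rmorphD, rmorphM) /= -DE -cE -eE.
  apply: (mulIf d0); rewrite mul0r -[RHS](mulr0 2) -[X in _ = _ * X]E8; ring.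
have n3 i j k : ci = 3 * i -> D = 3 * j -> ei = 3 * k -> False.
  move=> hc hD he; have := minimal_shift r s t m; rewrite VE.
  (* 2 A2 = 9 j k gives A2 = 9 A2 - 8 A2 = 9 (A2 - 4 j k). *)
  have [q A2q] : exists q, A2 = 9 * q.
    by exists (A2 - 4 * (j * k)); move: A2i; rewrite hD he; clear; lia.
  rewrite A1i A3i A2q hc he => mV.
  apply: (@minimal_ndvd 3 (i - k) q (i * q) 0 0) => //.
  rewrite !mulr0 mulrBr (_ : 3 ^+ 2 * q = 9 * q); last by ring.
  by rewrite (_ : 3 ^+ 3 * (i * q) = 3 * i * (9 * q)); last by ring.
have I3 : has_index W [:: 3; 4; 5; 6; 7; 8; 11; 12]%N.
  apply: index_mod3_neq0 red VE _ => k; rewrite A1i.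
  have [c' c3] := int_mod3 ci; have [d' d3] := int_mod3 D.
  have [e' e3] := int_mod3 ei.
  case: c3 => c3; case: d3 => d3; case: e3 => e3;
    [by case: (n3 _ _ _ c3 d3 e3)|..];
    (move: E A2i; rewrite c3 d3 e3; clear; lia).
have I2 : has_index W [:: 1; 2; 3; 4; 5; 6; 7; 10; 12]%N.
  have [c' c2] := int_mod2 ci; have [d' d2] := int_mod2 D.
  have [e' e2] := int_mod2 ei.
  have [a [A1p|A1p]] := int_mod2 A1.
    by apply: has_index_sub (index_even red VE _) _ => // k; rewrite A1p; clear; lia.
  apply: has_index_sub (index_odd red VE _ _) _ => // k; first by rewrite A1p; clear; lia.
  rewrite A1i in A1p; move: A1p E A2i; rewrite A3i.
  by case: c2 => ->; case: d2 => ->; case: e2 => ->; clear; lia.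
have I4 := order2_index red ef g4 g44.
exact: has_index_inter (has_index_inter I2 I3 isT isT) I4 isT isT.
Qed.

Lemma order2_x4_root (W : weierstrass int) (T : zmodType)
    (f : T -> point rat) (g : T) (x y : rat) : embedding (ratw W) f ->
  f g = Affine x y -> g + g = 0 ->
  exists n : int, n ^+ 3 + b2 W * n ^+ 2 + 8 * b4 W * n + 16 * b6 W = 0.
Proof.
move=> ef eg gg; have /intrP [n nE] := order2_x4_int ef eg gg.
exists n; apply: (@intr_inj rat); have := order2_root ef eg gg.
rewrite /psi2 b2_map b4_map b6_map => h.
rewrite [LHS](_ : _ = n%:~R ^+ 3 + (b2 W)%:~R * n%:~R ^+ 2
  + 8 * (b4 W)%:~R * n%:~R + 16 * (b6 W)%:~R); last by ring.
by rewrite -nE -[RHS](mulr0 16) -[X in _ = _ * X]h; ring.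
Qed.

Lemma order10_index (W : weierstrass int) (T : zmodType) (f : T -> point rat)
    (g : T) : reduced W -> minimal W -> embedding (ratw W) f ->
  g *+ 2 != 0 -> g *+ 5 != 0 -> g *+ 10 = 0 -> has_index W [:: 7]%N.
Proof.
move=> red m ef h0 q0 g10.
have h5 : g *+ 2 *+ 5 = 0 by rewrite -mulrnA.
have q2 : g *+ 5 + g *+ 5 = 0 by rewrite -mulrnDr.
have I5 := order5_index red m ef h0 h5.
have I2 := order2_index red ef q0 q2.
have [r [s [t [d [e [VE [f' ef']]]]]]] := order5_tate ef h0 h5.
have [x [y eq]] := embedding_affine ef' q0.
have [w E] := order2_x4_root ef' eq q2.
(* Orders 5 and 2 leave 7 and 12. If b2 = 2 modulo 3, then d and e are prime to 3, and the cubic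
   satisfied by 4 x(5P) has no root modulo 3. *)
have I3 : has_index W [:: 1; 2; 5; 6; 7; 8; 9; 10]%N.
  apply: index_mod3_neq2 red VE _ => k h.
  have {}E : w * w * w + (3 * k + 2) * (w * w) + 8 * ((d + e) * (d * (d * e))) * w
      + 16 * (d * (d * e) * (d * (d * e))) = 0.
    by rewrite -E -h /b2 /b4 /b6 /=; ring.
  have [d' d3] := int_mod3 d; have [e' e3] := int_mod3 e.
  have [w' w3] := int_mod3 w.
  by move: E h; case: d3 => ->; case: e3 => ->; case: w3 => ->; clear; lia.
exact: has_index_inter (has_index_inter I5 I2 isT isT) I3 isT isT.
Qed.


(** * Full 2-torsion together with a point of order 4 or 8 *)

(** Here a is A1, b is 4 A2, and the argument [a3] is the A3 of the Tate form. Since 2P has order 2,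
    A2 might have denominator 4; the conclusion is that it is an integer. *)
Lemma full4_arith (a0 a2 a3 r a q b : int) :
  a * b = 4 * a3 -> a * a + b = a0 * a0 + 4 * a2 + 12 * r ->
  q * q = a * a - 4 * b -> exists k, b = 4 * k.
Proof.
move=> h1 h2 h3; have [b' B1] := int_mod2 b; have [b'' B2] := int_mod2 b'.
have [a' A1] := int_mod2 a; have [a'' A2] := int_mod2 a'.
have [q' Q1] := int_mod2 q; have [q'' Q2] := int_mod2 q'.
have [c C] := int_mod2 a0.
case: B1 => B1; last first.
  exfalso; move: h1 h2 h3; rewrite B1; case: A1 => ->; last by clear; lia.
  case: A2 => ->; last by clear; lia.
  case: Q1 => ->; last by clear; lia.
  by case: Q2 => ->; case: C => ->; case: B2 => ->; clear; lia.
case: B2 => B2; first by exists b''; rewrite B1 B2; ring.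
exfalso; move: h1 h2 h3; rewrite B1 B2.
by case: A1 => ->; case: C => ->; clear; lia.
Qed.

(** [tate_form] needs x(2P) integral, which is unknown as 2P has order 2, so the Tate form is first
    built over the rationals. From 3P = - P follows A3 = A1 A2, and [psi2] factors as (x + A2) (4
    x^2 + A1^2 x + A1^2 A2). The root x(h) of the second factor makes its discriminant A1^2 (A1^2 -
    16 A2) a square. *)
Lemma full4_tate (W : weierstrass int) (T : zmodType) (f : T -> point rat)
    (g h : T) : embedding (ratw W) f -> g *+ 2 != 0 -> g *+ 4 = 0 ->
  h != 0 -> h + h = 0 -> h != g *+ 2 ->
  exists r s t a b q : int, [/\ shift r s t W = Weierstrass a b (a * b) 0 0,
    a != 0, q * q = a * a - 16 * b & exists2 f' : T -> point rat,
      embedding (ratw (Weierstrass a b (a * b) 0 0)) f' &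
      [/\ f' g = Affine 0 0, exists y, f' (g *+ 2) = Affine (- b%:~R) y &
        exists x y, f' h = Affine x y /\
          8 * x = q%:~R * a%:~R - a%:~R * a%:~R]].
Proof.
move=> ef g2 g4 h0 hh hg.
have g22 : g *+ 2 + g *+ 2 = 0 by rewrite -mulrnDr.
have g1 : g != 0 by apply: contraNneq g2 => ->; rewrite mul0rn.
have gg : g + g != 0 by rewrite -mulr2n.
have g3 : g *+ 3 = - g by apply/eqP; rewrite -addr_eq0 -mulrSr g4.
have g30 : g *+ 3 != 0 by rewrite g3 oppr_eq0.
have [x [y eg]] := embedding_affine ef g1.
have [x2 [y2 eg2]] := embedding_affine ef g2.
have xi := order4_int ef eg g2 g4.
have yi := on_curve_int (embedding_on_curve ef eg) xi.
have /intrP [X2 X2E] := order2_x4_int ef eg2 g22.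
case/intrP: xi => r rE; case/intrP: yi => t tE.
have [l [A1 [A2 [A3 [VE [ef' eg' _]]]]]] := tate_form_field ef eg gg.
set f' := _ \o f in ef'; have {}eg' : f' g = Affine 0 0 by [].
have [c [e [A1E A3E A20 c0 eg3]]] := tate_mult3 ef' eg' g2 g30.
have [A30 eg2'] := tate_mult2 ef' eg' g2.
have e0 : e = 0.
  have := embeddingN ef' eg'; rewrite -g3 eg3 => -[/eqP + _].
  by rewrite mulf_eq0 (negPf c0) => /eqP.
have {c e e0 c0 A1E A3E eg3} [A10 A3E] : A1 != 0 /\ A3 = A1 * A2.
  by rewrite A1E e0 subr0 A3E.
have A2E : x2 - x = - A2.
  by move: eg2'; rewrite /f' /= eg2 /= => -[<- _]; field.
have [xh [yh eh]] := embedding_affine ef' h0.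
have ph := order2_root ef' eh hh.
have nxh : xh + A2 != 0.
  apply/eqP => /eqP; rewrite addr_eq0 => /eqP xhE; rewrite xhE in eh.
  case: (embedding_eqx ef' eg2' eh) => /eqP; first by rewrite (negPf hg).
  have /eqP := g22; rewrite addr_eq0 => /eqP <-; by rewrite (negPf hg).
have {ph} ph : 4 * xh ^+ 2 + A1 ^+ 2 * xh + A1 ^+ 2 * A2 = 0.
  apply: (mulfI nxh); rewrite mulr0 -[RHS]ph /psi2 /b2 /b4 /b6 /= A3E; ring.
pose q := (8 * xh + A1 ^+ 2) / A1.
have qA : 8 * xh = q * A1 - A1 * A1 by rewrite divfK // addrK.
have qq : q ^+ 2 = A1 ^+ 2 - 16 * A2.
  apply: (mulfI (expf_neq0 2 A10)); rewrite -exprMn mulrC divfK //.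
  rewrite -[RHS](addr0) -[X in _ = _ + X](mulr0 16) -[X in _ = _ + _ * X]ph.
  ring.
have [E1 E2 E3] : [/\ A1 = (a1 W)%:~R + 2 * l,
    A2 = (a2 W)%:~R - l * (a1 W)%:~R + 3 * r%:~R - l ^+ 2 &
    A3 = (a3 W)%:~R + r%:~R * (a1 W)%:~R + 2 * t%:~R].
  by move: VE; rewrite -rE -tE => -[<- <- <-].
pose b : int := 4 * r - X2.
have bE : 4 * A2 = b%:~R.
  by rewrite /b rmorphB rmorphM /= -X2E -rE -[A2]opprK -A2E; ring.
clearbody b.
pose B := a1 W * a1 W + 4 * a2 W + 12 * r.
have BE : A1 ^+ 2 = B%:~R - b%:~R by rewrite -bE E1 E2 /B; ring.
have /intrP [a aE] : A1 \is a Num.int.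
  by apply: (@int_root2 0 (- (B - b))); rewrite BE; ring.
have /intrP [n nE] : q \is a Num.int.
  apply: (@int_root2 0 (- (B - b - 4 * b))); rewrite qq BE.
  rewrite [16 * A2](_ : _ = 4 * (4 * A2)); [rewrite bE|]; ring.
have h1 : a * b = 4 * (a3 W + r * a1 W + 2 * t).
  apply: (@intr_inj rat); rewrite [LHS](_ : _ = a%:~R * b%:~R); last by ring.
  rewrite -bE -aE mulrCA -A3E E3; ring.
have h2 : a * a + b = a1 W * a1 W + 4 * a2 W + 12 * r.
  apply: (@intr_inj rat); rewrite -/B.
  rewrite [LHS](_ : _ = a%:~R ^+ 2 + b%:~R); last by ring.
  by rewrite -aE BE subrK.
have h3 : n * n = a * a - 4 * b.
  apply: (@intr_inj rat).
  rewrite [LHS](_ : _ = n%:~R ^+ 2); last by ring.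
  rewrite [RHS](_ : _ = a%:~R ^+ 2 - 4 * b%:~R); last by ring.
  by rewrite -nE -aE qq -bE; ring.
have [k kE] := full4_arith h1 h2 h3.
have A2k : A2 = k%:~R.
  apply: (@mulfI _ 4) => //; rewrite bE kE; ring.
have /intrP [s sE] : l \is a Num.int.
  apply: (@int_root2 (a1 W) (- (a2 W + 3 * r - k))).
  rewrite [X in _ + X](_ : _ = - ((a2 W)%:~R + 3 * r%:~R - k%:~R)); last by ring.
  by rewrite -A2k E2; ring.
have A3k : A3 = (a * k)%:~R by rewrite A3E aE A2k rmorphM.
exists r, s, t, a, k, n; rewrite -(intr_eq0 rat) -aE; split=> //.
- move: (map_shift r s t W); rewrite -rE -sE -tE VE aE A2k A3k.
  case: (shift r s t W) => B1 B2 B3 B4 B6 [/eqP e1 /eqP e2 /eqP e3 /eqP e4 /eqP e6].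
  move: e1 e2 e3 e4 e6; rewrite !(eqr_int, intr_eq0).
  by do 5 (move=> /eqP ->).
- by rewrite h3 kE; ring.
exists f'; first by move: ef'; rewrite aE A2k A3k.
split=> //; first by exists (A1 * A2 - A3); rewrite eg2' A2k.
by exists xh, yh; rewrite eh qA aE nE.
Qed.


Lemma tate4_ndvd (p a b : int) : 1 < p ->
  ~ minimal (Weierstrass (p * a) (p ^+ 2 * b) (p * a * (p ^+ 2 * b)) 0 0).
Proof.
move=> p1 m; apply: (@minimal_ndvd p a b (a * b) 0 0 p1).
by rewrite !mulr0 (_ : p ^+ 3 * (a * b) = p * a * (p ^+ 2 * b)); last by ring.
Qed.

(** Modulo 3 the hypotheses give q^2 = 2 a^2, so 3 divides a and q, and then 9 divides 16 b. *)
Lemma full4_mod3 (a b q k : int) : q * q = a * a - 16 * b ->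
  a * a + 4 * b = 3 * k -> exists i j, a = 3 * i /\ b = 9 * j.
Proof.
move=> h1 h2; have [i A] := int_mod3 a; have [j Q] := int_mod3 q.
case: A => A; case: Q => Q;
  [|exfalso; move: h1 h2; rewrite A Q; clear; lia..].
(* From 16 b = 9 (i^2 - j^2) and b = 64 b - 63 b. *)
exists i, (4 * (i * i - j * j) - 7 * b); split=> //.
by move: h1; rewrite A Q; clear; lia.
Qed.

Lemma full4_index (W : weierstrass int) (T : zmodType) (f : T -> point rat)
    (g h : T) : reduced W -> minimal W -> embedding (ratw W) f ->
  g *+ 2 != 0 -> g *+ 4 = 0 -> h != 0 -> h + h = 0 -> h != g *+ 2 ->
  has_index W [:: 3; 5; 7; 12]%N.
Proof.
move=> red m ef g2 g4 h0 hh hg.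
have [r [s [t [a [b [q [VE _ qE _]]]]]]] := full4_tate ef g2 g4 h0 hh hg.
have I3 : has_index W [:: 3; 4; 5; 6; 7; 8; 11; 12]%N.
  apply: (index_mod3_neq0 red VE) => k E.
  have [i [j [aE bE]]] := full4_mod3 qE E.
  have := minimal_shift r s t m; rewrite VE aE bE.
  exact: (@tate4_ndvd 3).
have I2 : has_index W [:: 1; 2; 3; 4; 5; 6; 7; 10; 12]%N.
  have [a' [aE|aE]] := int_mod2 a; rewrite aE in VE.
    by apply: has_index_sub (index_even red VE _) _ => // k; clear; lia.
  apply: has_index_sub (index_odd red VE _ _) _ => // k; clear; first by lia.
  by have [b' [->|->]] := int_mod2 b; lia.
have I4 := order2_index red ef h0 hh.
exact: has_index_inter (has_index_inter I2 I3 isT isT) I4 isT isT.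
Qed.

(* The easy half of 2-descent. *)
Lemma double_sub_sqr (F : fieldType) (E : weierstrass F) (T : zmodType)
    (f : T -> point F) (g : T) (x y x' y' e : F) : 2 != 0 :> F ->
  embedding E f -> f g = Affine x y -> f (g + g) = Affine x' y' ->
  psi2 E e = 0 -> exists z, x' - e = z ^+ 2.
Proof.
move=> n2 ef eg eg2 pe; have [p0 E2] := double_x ef eg eg2.
have pE := psi2_sqr (embedding_on_curve ef eg).
set eta := 2 * y + _ + _ in pE.
have eta0 : eta != 0 by apply: contraNneq p0 => h; rewrite -pE h expr0n.
(* If e, e', e'' are the roots of [psi2], the numerator is (x - e)^2 - (e - e') (e - e''), and the
   product is a quarter of the derivative of [psi2] at e. *)
exists (((x - e) ^+ 2 - (6 * e ^+ 2 + b2 E * e + b4 E) / 2) / eta).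
rewrite expr_div_n pE; apply: (mulIf p0); rewrite mulfVK // mulrBl E2.
rewrite -[LHS]addr0 -[X in _ + X](mulr0 (2 * x + e + b2 E / 4)).
rewrite -[X in _ + _ * X]pe /dblnum /psi2 /b8 /b6 /b4 /b2; field.
by rewrite n2 (_ : 4 = 2 * 2) ?mulf_neq0 // -natrM.
Qed.

(** If a is even, b is odd. The first equation then gives a = 4 i, q = 4 j with j^2 = i^2 - b^2, i
    odd and j even, so w^2 = 32 i (i - j) has an odd power of 2. *)
Lemma full8_odd (a b q w : int) : q * q = a * a - 16 * (b * b) ->
  2 * a * (a - q) = w * w ->
  (forall k l, a = 2 * k -> b <> 2 * l) -> forall k, a <> 2 * k.
Proof.
move=> h1 h2 n2 k aE.
have [l [bE|bE]] := int_mod2 b; first exact: n2 aE bE.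
have [q1 qE] : exists q1, q = 2 * q1.
  have [q1 [qE|qE]] := int_mod2 q; first by exists q1.
  by exfalso; move: h1; rewrite aE qE; clear; lia.
have h3 : q1 * q1 = k * k - 4 * (b * b) by move: h1; rewrite aE qE; clear; lia.
have [i [kE|kE]] := int_mod2 k; last first.
  have [j qE2] := int_mod2 q1; have [i' I] := int_mod2 i; have [j' J] := int_mod2 j.
  by move: h3; rewrite bE kE; case: qE2 => ->; case: I => ->; case: J => ->;
    clear; lia.
have [j qE2] : exists j, q1 = 2 * j.
  have [j [qE2|qE2]] := int_mod2 q1; first by exists j.
  by exfalso; move: h3; rewrite kE qE2; clear; lia.
have h4 : j * j = i * i - b * b by move: h3; rewrite kE qE2; clear; lia.
have [i' [iE|iE]] := int_mod2 i.
  have [j' J] := int_mod2 j.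
  by move: h4; rewrite bE iE; case: J => ->; clear; lia.
have [j' [jE|jE]] := int_mod2 j; last first.
  by move: h4; rewrite bE iE jE; clear; lia.
have [w1 wE] : exists w1, w = 4 * w1.
  have [w1 [wE|wE]] := int_mod2 w; last first.
    by exfalso; move: h2; rewrite aE wE; clear; lia.
  have [w2 [wE2|wE2]] := int_mod2 w1; first by exists w2; rewrite wE wE2; ring.
  by exfalso; move: h2; rewrite aE kE qE qE2 wE wE2; clear; lia.
have [w2 W2] := int_mod2 w1.
by move: h2; rewrite aE kE qE qE2 wE iE jE; case: W2 => ->; clear; lia.
Qed.

Lemma full8_index (W : weierstrass int) (T : zmodType) (f : T -> point rat)
    (g h : T) : reduced W -> minimal W -> embedding (ratw W) f ->
  g *+ 4 != 0 -> g *+ 8 = 0 -> h != 0 -> h + h = 0 -> h != g *+ 4 ->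
  has_index W [:: 7]%N.
Proof.
move=> red m ef g4 g8 h0 hh hg.
have k2 : g *+ 2 *+ 2 != 0 by rewrite -mulrnA.
have k4 : g *+ 2 *+ 4 = 0 by rewrite -mulrnA.
have hk : h != g *+ 2 *+ 2 by rewrite -mulrnA.
have I1 := full4_index red m ef k2 k4 h0 hh hk.
have [r [s [t [a [b [q [VE a0 qE [f' ef' [ek [y2 e2] [xh [yh [eh xhE]]]]]]]]]]]] :=
  full4_tate ef k2 k4 h0 hh hk.
have g1 : g != 0 by apply: contraNneq g4 => ->; rewrite mul0rn.
have [x [y eg]] := embedding_affine ef' g1.
rewrite mulr2n in ek.
have k22 : g *+ 2 *+ 2 + g *+ 2 *+ 2 = 0 by rewrite -mulrnDr.
have n2 : 2 != 0 :> rat by [].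
(* In this Tate form x(2g) = 0, and the points of order 2 have abscissas - b and x(h); hence b and -
   x(h) are squares. *)
have [z zE] := double_sub_sqr n2 ef' eg ek (order2_root ef' e2 k22).
have [z' z'E] := double_sub_sqr n2 ef' eg ek (order2_root ef' eh hh).
have /intrP [c cE] : z \is a Num.int.
  apply: (@int_root2 0 (- b)); rewrite -zE; ring.
have bE : b = c * c.
  apply: (@intr_inj rat); rewrite rmorphM /= -expr2 -cE -zE; ring.
have z'E2 : (4 * z') ^+ 2 = (2 * a * (a - q))%:~R.
  rewrite exprMn -z'E [LHS](_ : _ = - 2 * (8 * xh)); last by ring.
  by rewrite xhE; ring.
have /intrP [w wE] : 4 * z' \is a Num.int.
  by apply: (@int_root2 0 (- (2 * a * (a - q)))); rewrite z'E2; ring.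
have h2 : 2 * a * (a - q) = w * w.
  by apply: (@intr_inj rat); rewrite -z'E2 wE [RHS]rmorphM expr2.
rewrite bE in qE VE.
have aodd : forall k, a <> 2 * k.
  apply: (full8_odd qE h2) => k l aE cE2.
  have := minimal_shift r s t m; rewrite VE aE cE2.
  rewrite (_ : 2 * l * (2 * l) = 2 ^+ 2 * (l * l)); last by ring.
  exact: (@tate4_ndvd 2).
have I2 : has_index W [:: 7; 10; 12]%N.
  apply: (index_odd red VE aodd) => k; have [i aE] := int_mod2 a.
  case: aE => aE; first by case: (aodd i aE).
  by rewrite aE; have [j [->|->]] := int_mod2 c; clear; lia.
(* If a^2 + 4 c^2 = 2 modulo 3, then a and c are prime to 3, so 3 divides q and w^2 = 2 a^2 modulo
   3, which is impossible. *)
have I3 : has_index W [:: 1; 2; 5; 6; 7; 8; 9; 10]%N.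
  apply: (index_mod3_neq2 red VE) => k E.
  have [a' a3] := int_mod3 a; have [c' c3] := int_mod3 c.
  have [q' q3] := int_mod3 q; have [w' w3] := int_mod3 w.
  move: E h2 qE.
  by case: a3 => ->; case: c3 => ->; case: q3 => ->; case: w3 => ->; clear; lia.
exact: has_index_inter (has_index_inter I1 I2 isT isT) I3 isT isT.
Qed.


(** * C_12 and C_2 x C_6: the case a1 = 0 *)

Lemma has_index_a1_neq0 (W : weierstrass int) (l : seq nat) : has_index W l ->
  a1 W <> 0 -> all (mem (iota 1 12)) l ->
  has_index W [seq i <- l | i \in [:: 7; 8; 9; 10; 11; 12]%N].
Proof.
move=> /hasP [i il iE] n0 /allP /(_ i il) i12; apply/hasP; exists i => //.
rewrite mem_filter il andbT.
have /allP /(_ i i12) /implyP : all (fun i => ((R i).1.1 != 0) ==>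
  (i \in [:: 7; 8; 9; 10; 11; 12]%N)) (iota 1 12) by [].
by apply; rewrite -(eqP iE); apply/eqP.
Qed.

Lemma order2_a3 (W : weierstrass int) (T : zmodType) (f : T -> point rat)
    (g : T) : reduced W -> embedding (ratw W) f -> g != 0 -> g + g = 0 ->
  a1 W = 0 -> a3 W = 0.
Proof.
move=> red ef g0 gg e1; have /hasP [i il iE] := order2_index red ef g0 gg.
have /allP /(_ i il) /implyP : all (fun i => ((R i).1.1 == 0) ==>
  ((R i).2 == 0)) [:: 1; 3; 5; 7; 8; 9; 10; 11; 12]%N by [].
by rewrite -(eqP iE) /= e1 => /(_ isT) /eqP.
Qed.

(** With a = 2 al, the first hypothesis is the 3-division polynomial of y^2 + a x y + a b y = x^3 +
    b x^2, and the second says that b2 + 12 x is a square, as in [order3_slope]. Parities are peeled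
    off until the model is seen to be reducible at 2. *)
Lemma order12_arith (al b x w : int) :
  3 * (x * x * x * x) + 4 * (al * al + b) * (x * x * x)
    + 12 * (al * al * b) * (x * x) + 12 * (al * al * (b * b)) * x
    + 4 * (al * al * (b * b * b)) = 0 ->
  4 * (al * al) + 4 * b + 12 * x = w * w ->
  (exists k, b = 4 * k) \/ (exists i k, al = 8 * i /\ b = 4 * k + 1).
Proof.
move=> h1 h2.
have [xi xE] : exists xi, x = 2 * xi.
  have [xi [xE|xE]] := int_mod2 x; first by exists xi.
  by exfalso; move: h1; rewrite xE; clear; lia.
have [w1 wE] : exists w1, w = 2 * w1.
  have [w1 [wE|wE]] := int_mod2 w; first by exists w1.
  by exfalso; move: h2; rewrite wE; clear; lia.
have {}h1 : 12 * (xi * xi * xi * xi) + 8 * (al * al + b) * (xi * xi * xi)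
    + 12 * (al * al * b) * (xi * xi) + 6 * (al * al * (b * b)) * xi
    + al * al * (b * b * b) = 0 by move: h1; rewrite xE; clear; lia.
have {}h2 : al * al + b + 6 * xi = w1 * w1 by move: h2; rewrite xE wE; clear; lia.
have [b1 [bE|bE]] := int_mod2 b.
  have [b2 [bE2|bE2]] := int_mod2 b1; first by left; exists b2; rewrite bE bE2; ring.
  exfalso; have [ka kE] : exists ka, xi = 2 * ka.
    have [ka [kE|kE]] := int_mod2 xi; first by exists ka.
    by exfalso; move: h1; rewrite kE bE; clear; lia.
  have [ga gE] : exists ga, al = 2 * ga.
    have [ga [gE|gE]] := int_mod2 al; first by exists ga.
    by exfalso; move: h1; rewrite kE gE bE bE2; clear; lia.
  have [w2 wE2] := int_mod2 w1.
  by move: h2; rewrite kE gE bE bE2; case: wE2 => ->; clear; lia.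
have [ga gE] : exists ga, al = 2 * ga.
  have [ga [gE|gE]] := int_mod2 al; first by exists ga.
  by exfalso; move: h1; rewrite gE bE; clear; lia.
have {}h1 : 3 * (xi * xi * xi * xi) + 2 * (4 * (ga * ga) + b) * (xi * xi * xi)
    + 12 * (ga * ga * b) * (xi * xi) + 6 * (ga * ga * (b * b)) * xi
    + ga * ga * (b * b * b) = 0 by move: h1; rewrite gE; clear; lia.
have {}h2 : 4 * (ga * ga) + b + 6 * xi = w1 * w1 by move: h2; rewrite gE; clear; lia.
have [ka [kE|kE]] := int_mod2 xi; last first.
  have [de [dE|dE]] := int_mod2 ga.
    by exfalso; move: h1; rewrite kE dE bE; clear; lia.
  have [b2 B2] := int_mod2 b1; have [de2 D2] := int_mod2 de.
  have [w2 wE2] := int_mod2 w1; have [w3 wE3] := int_mod2 w2.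
  have [b3 B3] := int_mod2 b2; have [ka2 K2] := int_mod2 ka.
  exfalso; move: h1 h2; rewrite kE dE bE.
  case: wE2 => ->; first by clear; lia.
  by case: D2 => ->; case: B2 => ->; case: B3 => ->; case: K2 => ->;
    case: wE3 => ->; clear; lia.
have [de [dE|dE]] := int_mod2 ga; last first.
  by exfalso; move: h1; rewrite kE dE bE; clear; lia.
have [ep [eE|eE]] := int_mod2 de; last first.
  by exfalso; move: h1; rewrite kE dE bE eE; clear; lia.
right; exists ep; have [w2 wE2] := int_mod2 w1; have [w3 wE3] := int_mod2 w2.
have [k kE2] : exists k, b = 4 * k + 1.
  have [k [kE2|kE2]] := int_mod2 b1; first by exists k; rewrite bE kE2; ring.
  exfalso; move: h2; rewrite kE dE bE kE2.
  by case: wE2 => ->; case: wE3 => ->; clear; lia.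
by exists k; split=> //; rewrite gE dE eE; ring.
Qed.

Lemma order12_a1 (W : weierstrass int) (T : zmodType) (f : T -> point rat)
    (g : T) : reduced W -> minimal W -> embedding (ratw W) f ->
  g *+ 4 != 0 -> g *+ 6 != 0 -> g *+ 12 = 0 -> a1 W <> 0.
Proof.
move=> red m ef g4 g6 g12 e1.
have g66 : g *+ 6 + g *+ 6 = 0 by rewrite -mulrnDr.
have e3 := order2_a3 red ef g6 g66 e1.
have h2 : g *+ 3 *+ 2 != 0 by rewrite -mulrnA.
have h4 : g *+ 3 *+ 4 = 0 by rewrite -mulrnA.
have h0 : g *+ 3 != 0 by apply: contraNneq h2 => ->; rewrite mul0rn.
have h3 : g *+ 3 *+ 3 = - (g *+ 3) by apply/eqP; rewrite -addr_eq0 -mulrSr h4.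
have h30 : g *+ 3 *+ 3 != 0 by rewrite h3 oppr_eq0.
have k3 : g *+ 4 *+ 3 = 0 by rewrite -mulrnA.
have [x [y eg]] := embedding_affine ef h0.
have [x2 [y2 eg2]] := embedding_affine ef h2.
have xi := order4_int ef eg h2 h4.
(* For a1 = a3 = 0, [psi2] is 4 times a monic integral cubic, so the point 6P of order 2 is integral
   and [tate_form] applies to 3P. *)
have x2i : x2 \is a Num.int.
  have h22 : g *+ 3 *+ 2 + g *+ 3 *+ 2 = 0 by rewrite -mulrnDr.
  have := order2_root ef eg2 h22; rewrite /psi2 /b2 /b4 /b6 /= e1 e3 => h.
  apply: (@int_root3 (a2 W) (a4 W) (a6 W)); apply: (@mulfI _ 4) => //.
  by rewrite mulr0 -[RHS]h; ring.
have [r [s [t [a [b [A3 [VE [f' ef' eg']]]]]]]] :=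
  tate_form ef eg eg2 xi x2i.
have [c [e [A1E A3E A20 c0 eg3]]] := tate_mult3 ef' eg' h2 h30.
rewrite /= in A1E A3E A20.
have {c e c0 A1E A3E eg3 A20} A3E : A3 = a * b.
  have := embeddingN ef' eg'; rewrite -h3 eg3 => -[/eqP + _].
  rewrite mulf_eq0 (negPf c0) => /eqP e0; apply: (@intr_inj rat).
  by rewrite rmorphM /= A1E e0 subr0 A3E.
rewrite {}A3E in VE ef'.
have aE : a = 2 * s by have [-> _ _] := shift_rel VE; rewrite e1 add0r.
have [x' [y' ek]] := embedding_affine ef' g4.
have /intrP [n nE] := odd_order_int ef' ek k3 isT.
have [l lE] := order3_slope ef' ek g4 k3.
have k2 : g *+ 4 + g *+ 4 = - (g *+ 4).
  by apply/eqP; rewrite -addr_eq0 -mulr2n -mulrSr k3.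
have ek2 := embeddingN ef' ek; rewrite -k2 in ek2.
have [_ D] := double_x ef' ek ek2.
have /intrP [w wE] : a%:~R + 2 * l \is a Num.int.
  apply: (@int_root2 0 (- (a * a + 4 * b + 12 * n))).
  rewrite [X in _ + X](_ : _ = - (b2 (ratw (Weierstrass a b (a * b) 0 0)) + 12 * n%:~R)).
    by rewrite -nE -lE /=; ring.
  by rewrite /b2 /=; ring.
have E2 : 4 * (s * s) + 4 * b + 12 * n = w * w.
  apply: (@intr_inj rat); rewrite [RHS](_ : _ = w%:~R ^+ 2); last by ring.
  by rewrite -wE [RHS]lE /b2 /= nE aE; ring.
have E1 : 3 * (n * n * n * n) + 4 * (s * s + b) * (n * n * n)
    + 12 * (s * s * b) * (n * n) + 12 * (s * s * (b * b)) * n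
    + 4 * (s * s * (b * b * b)) = 0.
  apply: (@intr_inj rat).
  (* 4P has order 3, so x(8P) = x(4P). *)
  transitivity (x' * psi2 (ratw (Weierstrass a b (a * b) 0 0)) x'
     - dblnum (ratw (Weierstrass a b (a * b) 0 0)) x'); last by rewrite D subrr.
  by rewrite nE /psi2 /dblnum /b8 /b6 /b4 /b2 /= aE; ring.
have [[k bE]|[i [k [sE bE]]]] := order12_arith E1 E2.
  have := minimal_shift r s t m; rewrite VE aE bE.
  exact: (@tate4_ndvd 2).
(* When 16 | a and b = 1 mod 4 the shift by s = 1 is divisible at 2. *)
have := minimal_shift 0 1 0 (minimal_shift r s t m); rewrite VE aE bE sE.
set V := shift 0 1 0 _.
have -> : V = Weierstrass (2 * (8 * i + 1)) (2 ^+ 2 * (k - 4 * i))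
    (2 ^+ 3 * (2 * i * (4 * k + 1))) (2 ^+ 4 * (- i * (4 * k + 1))) (2 ^+ 6 * 0).
  by rewrite /V /shift /=; congr Weierstrass; ring.
exact: minimal_ndvd.
Qed.

(** The cubic m^3 + s m^2 - t has no linear term, so m1 m2 + m1 m3 + m2 m3 = 0. This forces two even
    roots, and t = m1 m2 m3. *)
Lemma cubic_roots_arith (s t m1 m2 m3 : int) :
  m1 * m1 * m1 + s * (m1 * m1) = t -> m2 * m2 * m2 + s * (m2 * m2) = t ->
  m3 * m3 * m3 + s * (m3 * m3) = t -> m1 != m2 -> m1 != m3 -> m2 != m3 ->
  exists k, t = 4 * k.
Proof.
move=> h1 h2 h3 n12 n13 n23.
have p12 : m1 * m1 + m1 * m2 + m2 * m2 + s * (m1 + m2) = 0.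
  have n0 : m1 - m2 != 0 by rewrite subr_eq0.
  by apply: (mulfI n0); rewrite mulr0 -(subrr t) -{1}h1 -h2; ring.
have p13 : m1 * m1 + m1 * m3 + m3 * m3 + s * (m1 + m3) = 0.
  have n0 : m1 - m3 != 0 by rewrite subr_eq0.
  by apply: (mulfI n0); rewrite mulr0 -(subrr t) -{1}h1 -h3; ring.
have sE : s = - (m1 + m2 + m3).
  have n0 : m2 - m3 != 0 by rewrite subr_eq0.
  apply/eqP; rewrite -addr_eq0; apply/eqP.
  apply: (mulfI n0); rewrite mulr0.
  transitivity ((m1 * m1 + m1 * m2 + m2 * m2 + s * (m1 + m2))
    - (m1 * m1 + m1 * m3 + m3 * m3 + s * (m1 + m3))); first by ring.
  by rewrite p12 p13 subrr.
have e2 : m1 * m2 + m1 * m3 + m2 * m3 = 0.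
  transitivity (- (m1 * m1 + m1 * m2 + m2 * m2 + s * (m1 + m2))).
    by rewrite sE; ring.
  by rewrite p12 oppr0.
have tE : t = m1 * m2 * m3.
  transitivity (m1 * m2 * m3 - m1 * (m1 * m2 + m1 * m3 + m2 * m3)).
    by rewrite -h1 sE; ring.
  by rewrite e2 mulr0 subr0.
have [i1 I1] := int_mod2 m1; have [i2 I2] := int_mod2 m2.
have [i3 I3] := int_mod2 m3; rewrite tE.
case: I1 => I1; case: I2 => I2; case: I3 => I3;
  try by exfalso; move: e2; rewrite I1 I2 I3; clear; lia.
- by exists (2 * i1 * i2 * i3); rewrite I1 I2 I3; ring.
- by exists (i1 * i2 * m3); rewrite I1 I2; ring.
- by exists (i1 * m2 * i3); rewrite I1 I3; ring.
- by exists (m1 * i2 * i3); rewrite I2 I3; ring.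
Qed.

(** If a1 = 0, the Tate form at the point of order 3 is y^2 + 2 s x y + 2 t y = x^3. A point of
    order 2 has y = - (s x + t) and - y^2 = x^3, so n = y/x satisfies x = - n^2 and n^3 + s n^2 = t.
    The three points of order 2 give 4 | t, and the model is divisible at 2. *)
Lemma full6_a1 (W : weierstrass int) (T : zmodType) (f : T -> point rat)
    (g h1 h2 : T) : reduced W -> minimal W -> embedding (ratw W) f ->
  g != 0 -> g *+ 3 = 0 -> h1 != 0 -> h1 + h1 = 0 -> h2 != 0 -> h2 + h2 = 0 ->
  h1 != h2 -> a1 W <> 0.
Proof.
move=> red m ef g0 g3 n1 d1 n2 d2 n12 e1.
have e3 := order2_a3 red ef n1 d1 e1.
have g2 : g *+ 2 = - g by apply/eqP; rewrite -addr_eq0 -mulrSr g3.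
have g20 : g *+ 2 != 0 by rewrite g2 oppr_eq0.
have [x [y eg]] := embedding_affine ef g0.
have xi := odd_order_int ef eg g3 isT.
have eg2 : f (g + g) = Affine x (- y - a1 (ratw W) * x - a3 (ratw W)).
  by rewrite -mulr2n g2 (embeddingN ef eg).
have [r [s [t [a [b [A3 [VE [f' ef' eg']]]]]]]] := tate_form ef eg eg2 xi xi.
have [A30 eg2'] := tate_mult2 ef' eg' g20.
have b0 : b = 0.
  move: eg2'; rewrite g2 (embeddingN ef' eg') => -[/eqP + _].
  by rewrite eq_sym oppr_eq0 intr_eq0 => /eqP.
have [aE _ A3E] := shift_rel VE.
rewrite e1 add0r in aE; rewrite e1 e3 mulr0 !add0r in A3E.
rewrite {}b0 {}aE {}A3E in VE ef' A30 {eg2'}.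
have t0 : t%:~R != 0 :> rat.
  by apply: contraNneq A30 => tE; rewrite /= rmorphM /= tE mulr0.
have root h : h != 0 -> h + h = 0 -> exists n : int,
    n * n * n + s * (n * n) = t /\ exists yh, f' h = Affine (- (n * n)%:~R) yh.
  move=> h0 hh; have [xh [yh eh]] := embedding_affine ef' h0.
  have := embedding_order2 ef' eh hh; rewrite /= !rmorphM /= => yE.
  have {}yE : yh = - (s%:~R * xh + t%:~R).
    by apply: (@mulfI _ 2) => //; apply/eqP; rewrite -subr_eq0 -[X in _ == X]yE;
      apply/eqP; ring.
  have c := embedding_on_curve ef' eh.
  have {}c : - yh ^+ 2 = xh ^+ 3.
    transitivity (yh ^+ 2 + 2 * yh * (s%:~R * xh + t%:~R)).
      by rewrite -[s%:~R * xh + t%:~R]opprK -yE; ring.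
    by move: c => /= c; etransitivity; [|etransitivity; [exact: c|]]; ring.
  have x0 : xh != 0.
    apply: contraNneq t0 => x0; move: c yE; rewrite x0 mulr0 add0r expr0n /=.
    by move/eqP; rewrite oppr_eq0 expf_eq0 /= => /eqP -> /eqP; rewrite eq_sym oppr_eq0.
  pose n := yh / xh.
  have nn : n ^+ 2 = - xh.
    by rewrite expr_div_n -[yh ^+ 2]opprK c; field.
  have nE : n ^+ 3 + s%:~R * n ^+ 2 = t%:~R.
    have yn : yh = n * xh by rewrite divfK.
    have -> : n ^+ 3 = - yh by rewrite exprS nn mulrN -yn.
    by rewrite nn yE; ring.
  have /intrP [k kE] : n \is a Num.int.
    by apply: (@int_root3 s 0 (- t)); rewrite rmorphN /= -nE; ring.
  exists k; split.
    apply: (@intr_inj rat); rewrite -nE kE; ring.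
  by exists yh; rewrite eh; congr Affine; rewrite rmorphM /= -kE -expr2 nn opprK.
have h12 : h1 + h2 != 0.
  by rewrite addr_eq0; apply: contra_neq n12 => ->; apply/eqP; rewrite eq_sym -addr_eq0 d2.
have d12 : h1 + h2 + (h1 + h2) = 0 by rewrite addrACA d1 d2 addr0.
have [m1 [r1 [y1 f1]]] := root _ n1 d1; have [m2 [r2 [y2 f2]]] := root _ n2 d2.
have [m3 [r3 [y3 f3]]] := root _ h12 d12.
have ne h h' (k k' : int) z z' : f' h = Affine (- (k * k)%:~R) z ->
    f' h' = Affine (- (k' * k')%:~R) z' -> h + h = 0 -> h != h' -> k != k'.
  move=> eh eh' /eqP; rewrite addr_eq0 => /eqP hN hh'.
  apply: contra_neq hh' => kk; rewrite -kk in eh'.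
  by case: (embedding_eqx ef' eh eh') => ->; rewrite -?hN.
have n13 : h1 != h1 + h2 by rewrite -subr_eq0 opprD addNKr oppr_eq0.
have n23 : h2 != h1 + h2 by rewrite addrC -subr_eq0 opprD addNKr oppr_eq0.
have [k tE] := cubic_roots_arith r1 r2 r3 (ne _ _ _ _ _ _ f1 f2 d1 n12)
  (ne _ _ _ _ _ _ f1 f3 d1 n13) (ne _ _ _ _ _ _ f2 f3 d2 n23).
have := minimal_shift r s t m; rewrite VE tE.
have -> : Weierstrass (2 * s) 0 (2 * (4 * k)) 0 0 = Weierstrass (2 * s)
    (2 ^+ 2 * 0) (2 ^+ 3 * k) (2 ^+ 4 * 0) (2 ^+ 6 * 0).
  by congr Weierstrass; ring.
exact: minimal_ndvd.
Qed.


(** * Reduced minimal models *)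

Lemma mazur_index (W : weierstrass int) (T : mazur_group)
    (f : mazur_carrier T -> point rat) : reduced W -> minimal W ->
  embedding (ratw W) f -> has_index W (rmm_indices T).
Proof.
move=> red m; case: T f => f ef; rewrite [rmm_indices _]/=.
- by apply: reduced_has_index => // i i12; rewrite [_ \in _]i12.
- by apply: (order2_index (g := inZp 1) red ef); try exact/eqP.
- by apply: (order3_index (g := inZp 1) red ef); try exact/eqP.
- by apply: (order2_index (g := inZp 2) red ef); try exact/eqP.
- by apply: (order5_index (g := inZp 1) red m ef); try exact/eqP.
- apply: (has_index_inter (order3_index (g := inZp 2) red ef _ _)
    (order2_index (g := inZp 3) red ef _ _) isT isT) => //; exact/eqP.
- by apply: (order7_index (g := inZp 1) red m ef); try exact/eqP.
- by apply: (order8_index (g := inZp 1) red m ef); try exact/eqP.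
- by apply: (order9_index (g := inZp 1) red m ef); try exact/eqP.
- by apply: (order10_index (g := inZp 1) red m ef); try exact/eqP.
- have I6 : has_index W [:: 1; 5; 7; 8; 9; 10]%N.
    apply: (has_index_inter (order3_index (g := inZp 4) red ef _ _)
      (order2_index (g := inZp 6) red ef _ _) isT isT) => //; exact/eqP.
  apply: (has_index_a1_neq0 I6 (order12_a1 (g := inZp 1) red m ef _ _ _)) => //.
  exact/eqP.
- by apply: (order2_index (g := (inZp 1, inZp 0)) red ef); try exact/eqP.
- by apply: (full4_index (g := (inZp 0, inZp 1)) (h := (inZp 1, inZp 0)) red m ef);
    try exact/eqP.
- have I6 : has_index W [:: 1; 5; 7; 8; 9; 10]%N.
    apply: (has_index_inter (order3_index (g := (inZp 0, inZp 2)) red ef _ _)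
      (order2_index (g := (inZp 1, inZp 0)) red ef _ _) isT isT) => //; exact/eqP.
  apply: (has_index_a1_neq0 I6 (full6_a1 (g := (inZp 0, inZp 2))
    (h1 := (inZp 1, inZp 0)) (h2 := (inZp 0, inZp 3)) red m ef _ _ _ _ _ _ _)) => //;
  exact/eqP.
- by apply: (full8_index (g := (inZp 0, inZp 1)) (h := (inZp 1, inZp 0)) red m ef);
    try exact/eqP.
Qed.

(** * Existence and uniqueness of the reduced minimal model *)

Lemma rat_common_denominator (q D n : rat) (k : nat) : n \is a Num.int ->
  D = (denq q)%:~R * n -> q * D ^+ k.+1 \is a Num.int.
Proof.
move=> ni ->; have d0 : (denq q)%:~R != 0 :> rat by rewrite intr_eq0 denq_neq0.
rewrite -{1}(divq_num_den q) exprMn exprS !mulrA divfK //.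
by rewrite rpredM ?rpredX // rpredM ?rpredX // rpred_int.
Qed.

Lemma integral_model (E : weierstrass rat) :
  exists W : weierstrass int, isomorphic E (ratw W).
Proof.
case: E => c1 c2 c3 c4 c6.
have [D [D0 DE]] : exists D : rat, D != 0 /\ forall q k,
    q \in [:: c1; c2; c3; c4; c6] -> q * D ^+ k.+1 \is a Num.int.
  exists (\prod_(q <- [:: c1; c2; c3; c4; c6]) (denq q)%:~R); split.
    by rewrite prodf_seq_neq0; apply/allP => q _; rewrite intr_eq0 denq_neq0.
  move=> q k qc; rewrite (perm_big _ (perm_to_rem qc)) big_cons /=.
  apply: (rat_common_denominator _ _ erefl).
  by apply: rpred_prod => q' _; rewrite rpred_int.
have /intrP [n1 h1] : c1 * D ^+ 0.+1 \is a Num.int by rewrite DE // !inE eqxx ?orbT.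
have /intrP [n2 h2] : c2 * D ^+ 1.+1 \is a Num.int by rewrite DE // !inE eqxx ?orbT.
have /intrP [n3 h3] : c3 * D ^+ 2.+1 \is a Num.int by rewrite DE // !inE eqxx ?orbT.
have /intrP [n4 h4] : c4 * D ^+ 3.+1 \is a Num.int by rewrite DE // !inE eqxx ?orbT.
have /intrP [n6 h6] : c6 * D ^+ 5.+1 \is a Num.int by rewrite DE // !inE eqxx ?orbT.
exists (Weierstrass n1 n2 n3 n4 n6), D^-1, 0, 0, 0; rewrite invr_eq0; split=> //.
rewrite /map_weierstrass /change_vars /= -h1 -h2 -h3 -h4 -h6 !exprVn !invrK.
by congr Weierstrass; ring.
Qed.

(** Descent on the absolute discriminant; excluded middle decides whether a smaller integral model
    exists. *)
Lemma global_minimal_model_exists (E : weierstrass rat) :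
  exists W : weierstrass int, global_minimal_model E W.
Proof.
have [W0 iso0] := integral_model E; have [n] := ubnP `|disc W0|%N.
elim: n W0 iso0 => // n IH W0 iso0 W0n.
have [[W iso dW]|H] := classic (exists2 W : weierstrass int,
    isomorphic E (ratw W) & (`|disc W| < `|disc W0|)%N).
  by apply: IH iso _; rewrite ltnS in W0n; apply: leq_trans dW W0n.
exists W0; split=> // W iso; rewrite -!abszE lez_nat leqNgt.
by apply/negP => lt; apply: H; exists W.
Qed.

(** s normalizes a1 modulo 2, then r normalizes a2 modulo 3, then t normalizes a3 modulo 2; the + 1
    before dividing by 3 centres the residue at 0. *)
Lemma reduced_shift (W : weierstrass int) :
  exists r s t : int, reduced (shift r s t W).
Proof.
pose s := - (a1 W %/ 2)%Z; pose c := a2 W - s * a1 W - s ^+ 2.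
pose r := - ((c + 1) %/ 3)%Z; pose e := a3 W + r * a1 W.
exists r, s, (- (e %/ 2)%Z); split; rewrite !inE /=.
- by rewrite /s; lia.
- by rewrite -/e; lia.
rewrite (_ : _ - _ ^+ 2 = c + 3 * r); last by rewrite /c; ring.
by rewrite /r; lia.
Qed.

Lemma shift_b6 (A : comNzRingType) (r s t : A) (E : weierstrass A) :
  b6 (shift r s t E) = b6 E + 2 * r * b4 E + r ^+ 2 * b2 E + 4 * r ^+ 3.
Proof. by rewrite /b6 /b4 /b2 /=; ring. Qed.

Lemma shift_b8 (A : comNzRingType) (r s t : A) (E : weierstrass A) :
  b8 (shift r s t E) = b8 E + 3 * r * b6 E + 3 * r ^+ 2 * b4 E + r ^+ 3 * b2 E
    + 3 * r ^+ 4.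
Proof. by rewrite /b8 /b6 /b4 /b2 /=; ring. Qed.

(** Composition with the automorphism P -> - P turns u = -1 into u = 1. *)
Lemma change_varsN1 (F : fieldType) (r s t : F) (E : weierstrass F) :
  exists s' t', change_vars (- 1) r s t E = shift r s' t' E.
Proof.
pose V := shift r s t E; exists (s - a1 V), (t - a3 V).
have e2 : (- 1 : F) ^+ 2 = 1 by ring.
have e3 : (- 1 : F) ^+ 3 = - 1 by ring.
have e4 : (- 1 : F) ^+ 4 = 1 by ring.
have e6 : (- 1 : F) ^+ 6 = 1 by ring.
rewrite /change_vars e2 e3 e4 e6 !divr1 invrN1.
by rewrite /V /shift /=; congr Weierstrass; ring.
Qed.

Lemma map_intr_inj (W W' : weierstrass int) :
  ratw W = ratw W' -> W = W'.
Proof.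
case: W => c1 c2 c3 c4 c6; case: W' => d1 d2 d3 d4 d6 [e1 e2 e3 e4 e6].
by congr Weierstrass; apply: (@intr_inj rat).
Qed.

(* [r] is integral because its denominator divides the leading coefficients 4 and
   3 of the transformation formulas of b6 and b8. *)
Lemma integral_shift (W W' : weierstrass int) (r s t : rat) :
  ratw W' = shift r s t (ratw W) ->
  exists r' s' t' : int, W' = shift r' s' t' W.
Proof.
move=> e.
have := congr1 (@b6 _) e; rewrite shift_b6 b2_map !b4_map !b6_map => e6.
have := congr1 (@b8 _) e; rewrite shift_b8 b2_map b4_map b6_map !b8_map => e8.
have d4 : (denq r %| 4)%Z.
  apply: (@denq_root4 4 (b2 W) (2 * b4 W) (b6 W - b6 W') 0).
  rewrite [LHS](_ : _ = r * ((b6 W)%:~R + 2 * r * (b4 W)%:~R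
    + r ^+ 2 * (b2 W)%:~R + 4 * r ^+ 3 - (b6 W')%:~R)); last by ring.
  by rewrite -e6 subrr mulr0.
have d3 : (denq r %| 3)%Z.
  apply: (@denq_root4 3 (b2 W) (3 * b4 W) (3 * b6 W) (b8 W - b8 W')).
  rewrite [LHS](_ : _ = (b8 W)%:~R + 3 * r * (b6 W)%:~R + 3 * r ^+ 2 * (b4 W)%:~R
    + r ^+ 3 * (b2 W)%:~R + 3 * r ^+ 4 - (b8 W')%:~R); last by ring.
  by rewrite -e8 subrr.
have /intrP [r' rE] : r \is a Num.int.
  apply: int_denq_dvd1; rewrite (_ : 1 = 4 - 3 :> int) //.
  by rewrite rpredB. 
have [f1 f2 f3 f4 f6] := e.
have /intrP [s' sE] : s \is a Num.int.
  apply: (@int_root2 (a1 W) (a2 W' - a2 W - 3 * r')).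
  by rewrite !(rmorphB, rmorphM) /= f2 rE /=; ring.
have /intrP [t' tE] : t \is a Num.int.
  apply: (@int_root2 (a3 W + r' * a1 W)
    (a6 W' - (a6 W + r' * a4 W + r' ^+ 2 * a2 W + r' ^+ 3))).
  by rewrite !(rmorphB, rmorphD, rmorphM, rmorphXn) /= f6 rE /=; ring.
exists r', s', t'; apply: map_intr_inj.
by rewrite map_shift -rE -sE -tE.
Qed.

Lemma reduced_shift_eq (W : weierstrass int) (r s t : int) :
  reduced W -> reduced (shift r s t W) -> shift r s t W = W.
Proof.
case: W => c1 c2 c3 c4 c6 [/= r1 r3 r2] [/= q1 q3 q2]; rewrite !inE in r1 r2 r3 q1 q2 q3.
have s0 : s = 0 by clear -r1 q1; lia.
rewrite s0 in q2 *.
have r0 : r = 0 by move: q2; rewrite mul0r expr2 mul0r; clear -r2; lia.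
rewrite r0 in q3 *.
have t0 : t = 0 by move: q3; rewrite mul0r; clear -r3; lia.
by rewrite t0 /shift /=; congr Weierstrass; ring.
Qed.

Lemma disc_map (W : weierstrass int) : disc (ratw W) = (disc W)%:~R.
Proof. by rewrite /disc b2_map b4_map b6_map b8_map; ring. Qed.

(** The discriminants differ by u^12, so u is 1 or -1. *)
Lemma isomorphic_minimal_shift (W W' : weierstrass int) :
  disc W != 0 -> `|disc W| = `|disc W'| -> isomorphic (ratw W) (ratw W') ->
  exists r s t : int, W' = shift r s t W.
Proof.
move=> d0 dd [u [r [s [t [u0 e]]]]].
have := congr1 (@disc _) e; rewrite disc_change_vars // !disc_map => dE.
have u1 : `|u| ^+ 12 = 1.
  have dq : `|(disc W)%:~R| != 0 :> rat by rewrite normr_eq0 intr_eq0.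
  have : `|(disc W')%:~R| = `|(disc W)%:~R| :> rat by rewrite -!intr_norm dd.
  rewrite dE normrM normfV normrX => h; apply: (mulfI dq).
  by rewrite mulr1 -{1}h divfK // expf_neq0 // normr_eq0.
move/eqP: u1; rewrite pexpr_eq1 // eqr_norml ler01 andbT => /orP [] /eqP uE.
  by rewrite uE change_vars1 in e; apply: integral_shift e.
rewrite uE in e; have [s' [t' E]] := change_varsN1 r s t (ratw W).
by rewrite E in e; apply: integral_shift e.
Qed.

Lemma reduced_minimal_model_exists (E : weierstrass rat) : elliptic E ->
  exists W, [/\ unique (reduced_minimal_model E) W, reduced W, minimal W &
    isomorphic E (ratw W)].
Proof.
move=> ell; have [W0 [iso0 min0]] := global_minimal_model_exists E.
have [r [s [t red]]] := reduced_shift W0; set W := shift r s t W0 in red.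
have iso : isomorphic E (ratw W).
  by apply: isomorphic_trans iso0 _; rewrite map_shift; apply: isomorphic_shift.
have minE W' : isomorphic E (ratw W') -> `|disc W| <= `|disc W'|.
  by rewrite disc_shift; apply: min0.
have d0 : disc W != 0.
  have [u [r1 [s1 [t1 [u0 e]]]]] := iso.
  rewrite -(intr_eq0 rat) -disc_map e disc_change_vars //.
  by rewrite mulf_neq0 // invr_eq0 expf_neq0.
exists W; split=> //; last first.
  by split=> // W' iso'; apply: minE; apply: isomorphic_trans iso iso'.
case: (red) => red1 red3 red2; split; first by [].
move=> W' [[iso' min'] h1 h3 h2].
have dd : `|disc W| = `|disc W'| by apply/eqP; rewrite eq_le minE ?min'.
have [r' [s' [t' e]]] := isomorphic_minimal_shift d0 dd
  (isomorphic_trans (isomorphic_sym iso) iso').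
by rewrite e (reduced_shift_eq red) // -e.
Qed.

Unset Implicit Arguments.

Theorem theoremA (E : weierstrass rat) (T : mazur_group) :
  elliptic E ->
  embeds_in_torsion E (mazur_carrier T) ->
  exists i : nat, i \in rmm_indices T /\ rmm_eq E (R i).
Proof.
move=> ell [f [fI fT fD]].
have [W [uW red m [u [r [s [t [u0 e]]]]]]] := reduced_minimal_model_exists ell.
have ef : embedding E f by split=> // g; case: (fT g).
have := embedding_move r s t u0 ef; rewrite -e => ef'.
have /hasP [i il /eqP iE] := mazur_index red m ef'.
by exists i; split=> //; exists W.
Qed.
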